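(* For any given $\vec u_0=(u_1^0,\dots,u_{m+n}^0)\in[0,R]^{m+n}$ (regarded as an initial condition constant on each road) there exists a self-similar function $\vec\rho=(\rho_1,\dots,\rho_{m+n})\in L^\infty(\mathbb R_+\times\Gamma;[0,R]^{m+n})$ (i.e. each $\rho_h(t,x)$ depends only on the ratio $x/t$) which is an admissible solution of the junction problem $\rho_{h,t}+f_h(\rho_h)_x=0$, $h=1,\dots,m+n$, with initial condition $\vec u_0$. In particular, the vector $\vec{\gamma\rho}=(\gamma_1\rho_1,\dots,\gamma_{m+n}\rho_{m+n})$ of traces of this solution at the junction belongs to $\mathcal G_{VV}$.
   Context: Setting. $m,n\ge1$ are integers, $R>0$. A junction located at $x=0$ connects $m$ incoming roads $\Omega_i=(-\infty,0)$, $i\in\{1,\dots,m\}$, and $n$ outgoing roads $\Omega_j=(0,+\infty)$, $j\in\{m+1,\dots,m+n\}$; $h$ denotes any road index. The equation $\rho_{h,t}+f_h(\rho_h)_x=0$ is posed on $\mathbb R_+\times\Omega_h$. The fluxes satisfy, for all $h$: (F) $f_h:[0,R]\to[0,+\infty)$ is Lipschitz with $\|f_h'\|_\infty\le L_h$, $f_h(0)=f_h(R)=0$, and there exists $\bar\rho_h\in(0,R)$ such that $f_h'(\rho)(\bar\rho_h-\rho)>0$ for a.e. $\rho\in[0,R]$; (NLD) $f_h'$ is not constant on any non-trivial subinterval of $[0,R]$. $L^\infty(\mathbb R_+\times\Gamma;[0,R]^{m+n})$ is the set of $(\rho_1,\dots,\rho_{m+n})$ with $\rho_h\in L^\infty(\mathbb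 R_+\times\Omega_h;[0,R])$. Godunov flux: $G_h(a,b)=\min_{s\in[a,b]}f_h(s)$ if $a\le b$ and $G_h(a,b)=\max_{s\in[b,a]}f_h(s)$ if $a\ge b$. Kruzhkov entropy flux: $q_h(u,v)=\mathrm{sign}(u-v)(f_h(u)-f_h(v))$. Kruzhkov inequalities (K) with datum $\vec u_0$: for each $h$, each $k\in[0,R]$ and each nonnegative $\xi\in C_c^\infty([0,\infty)\times\overline{\Omega_h})$ with $\xi(\cdot,0)=0$, $$\int_{\mathbb R_+}\int_{\Omega_h}\{|\rho_h-k|\xi_t+q_h(\rho_h,k)\xi_x\}\,dx\,dt+\int_{\Omega_h}|u_h^0-k|\,\xi(0,x)\,dx\ge0.$$ It is known that under (K) and (NLD) each $\rho_h$ has a strong $L^1_{loc}$ trace $\gamma_h\rho_h$ on $\mathbb R_+\times\{0\}$, e.g. $\lim_{k\to0^+}\frac1k\int_{\mathbb R_+}\int_0^k\xi(t)|\rho_j(t,x)-\gamma_j\rho_j(t)|\,dx\,dt=0$ for all test functions $\xi$ (and analogously on incoming roads). Admissible solution with datum $\vec u_0$: (K) holds and there is $p\in L^\infty(\mathbb R_+;[0,R])$ such that for a.e. $t$: $f_i(\gamma_i\rho_i(t))=G_i(\gamma_i\rho_i(t),p(t))$ for all $i\le m$, $f_j(\gamma_j\rho_j(t))=G_j(p(t),\gamma_j\rho_j(t))$ for all $j\ge m+1$, and $\sum_{i=1}^mG_i(\gamma_i\rho_i(t),p(t))=\sum_{j=m+1}^{m+n}G_j(p(t),\gamma_j\rho_j(t))$.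 Vanishing viscosity germ: $\mathcal G_{VV}$ is the set of $\vec u\in[0,R]^{m+n}$ for which there exists $p\in[0,R]$ such that $\sum_{i=1}^mG_i(u_i,p)=\sum_{j=m+1}^{m+n}G_j(p,u_j)$, $G_i(u_i,p)=f_i(u_i)$ for all $i$, and $G_j(p,u_j)=f_j(u_j)$ for all $j$. *)

(* Defs.v *)
From HB Require Import structures.
From mathcomp Require Import all_boot all_order all_algebra.
From mathcomp Require Import all_classical all_reals all_analysis.
Set Implicit Arguments.
Unset Strict Implicit.
Unset Printing Implicit Defensive.
Import Order.TTheory GRing.Theory Num.Theory.
Import numFieldNormedType.Exports.
Local Open Scope classical_set_scope.
Local Open Scope ring_scope.

Section Flux.
Context {R : realType}.
Implicit Types (rmax L : R) (f : R -> R).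

(* A flux is a function on [0, rmax]; its values elsewhere are irrelevant. The
   derivative is only looked at in ]0, rmax[ because a derivative at an endpoint
   would involve values of f outside [0, rmax]. As derive1 is total, "f' exists" is
   stated through derivable; for a Lipschitz f this holds almost everywhere. *)
Definition flux_condition rmax L f : Prop :=
  [/\ forall r, r \in `[0, rmax] -> 0 <= f r,
      [lipschitz f r | r in `[0, rmax]],
      {ae (@lebesgue_measure R), forall r, r \in `]0, rmax[ ->
         derivable f r 1 /\ `|derive1 f r| <= L},
      f 0 = 0 /\ f rmax = 0 &
      exists2 rbar, rbar \in `]0, rmax[ &
        {ae (@lebesgue_measure R), forall r, r \in `]0, rmax[ ->
           derivable f r 1 /\ 0 < derive1 f r * (rbar - r)}].

(* f' is defined almost everywhere only, so "constant" means a.e. constant. *)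
Definition nondegenerate_nonlinearity rmax f : Prop :=
  forall a b, 0 <= a -> a < b -> b <= rmax ->
  ~ exists c, {ae (@lebesgue_measure R), forall r, r \in `]a, b[ ->
                 derivable f r 1 /\ derive1 f r = c}.

(* The extrema are attained when f is continuous on the interval. *)
Definition godunov f (a b : R) : R :=
  if a <= b then inf [set f s | s in `[a, b]]
  else sup [set f s | s in `[b, a]].

Definition kruzhkov f (u v : R) : R := Num.sg (u - v) * (f u - f v).

End Flux.

Section TestFunctions.
Context {R : realType}.

Definition compactly_supported {T : topologicalType} (xi : T -> R) : Prop :=
  compact (closure [set z | xi z != 0]).

Definition Ccinfty1 (xi : R -> R) : Prop :=
  (forall k t, derivable (derive1n k xi) t 1) /\ compactly_supported xi.

(* Points of R * R are pairs (t, x). *)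
Definition partial_t (xi : R * R -> R) (z : R * R) : R :=
  derive1 (fun t => xi (t, z.2)) z.1.

Definition partial_x (xi : R * R -> R) (z : R * R) : R :=
  derive1 (fun x => xi (z.1, x)) z.2.

(* w lists the partial derivatives to be taken: true for t, false for x. *)
Definition iter_partial (w : seq bool) (xi : R * R -> R) : R * R -> R :=
  foldr (fun b g => if b then partial_t g else partial_x g) xi w.

Definition smooth2 (xi : R * R -> R) : Prop :=
  forall w : seq bool, let g := iter_partial w xi in
  continuous g /\
  forall t x, derivable (fun s => g (s, x)) t 1 /\
              derivable (fun y => g (t, y)) x 1.

Definition Ccinfty2 (xi : R * R -> R) : Prop :=
  smooth2 xi /\ compactly_supported xi.

End TestFunctions.

Section Junction.
Context {R : realType} {m n : nat}.
Implicit Types (rmax : R) (f : 'I_(m + n) -> R -> R) (h : 'I_(m + n)).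
Implicit Types (u : 'I_(m + n) -> R) (rho : 'I_(m + n) -> R * R -> R).

Local Notation mu := (@lebesgue_measure R).
Local Notation Rplus := (`[(0 : R), +oo[%classic : set R).

(* Incoming roads have index lshift n i, i < m; outgoing ones rshift m j, j < n. *)
Definition road h : set R := if (h < m)%N then `]-oo, 0[%classic else `]0, +oo[%classic.

Definition near_junction h (k : R) : set R :=
  if (h < m)%N then `](- k), 0[%classic else `]0, k[%classic.

(* A [0, rmax]-valued measurable representative of a class in L^oo(D; [0, rmax]). *)
Definition Linfty d (T : measurableType d) (D : set T) rmax (g : T -> R) : Prop :=
  measurable_fun D g /\ forall z, D z -> g z \in `[0, rmax].

Definition Linfty_network rmax rho : Prop :=
  forall h, Linfty (Rplus `*` road h) rmax (rho h).

(* Test functions of class C_c^oo([0, +oo[ * closure (road h)) are the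
   restrictions to this set of functions in C_c^oo(R * R). *)
Definition kruzhkov_inequalities rmax f (u0 : 'I_(m + n) -> R -> R) rho : Prop :=
  forall h (k : R) (xi : R * R -> R),
    k \in `[0, rmax] -> Ccinfty2 xi ->
    (forall t x, 0 <= t -> closure (road h) x -> 0 <= xi (t, x)) ->
    (forall t, 0 <= t -> xi (t, 0) = 0) ->
    (0 <= (\int[mu]_(t in Rplus) \int[mu]_(x in road h)
             (`|rho h (t, x) - k| * partial_t xi (t, x)
              + kruzhkov (f h) (rho h (t, x)) k * partial_x xi (t, x))%:E)
          + \int[mu]_(x in road h) (`|u0 h x - k| * xi (0, x))%:E)%E.

Definition is_trace rmax h (r : R * R -> R) (g : R -> R) : Prop :=
  Linfty Rplus rmax g /\
  forall xi : R -> R, Ccinfty1 xi ->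
    ((k^-1)%:E * \int[mu]_(t in Rplus) \int[mu]_(x in near_junction h k)
                   (xi t * `|r (t, x) - g t|)%:E)%E @[k --> 0^'+] --> 0%E.

Definition junction_condition f u (p : R) : Prop :=
  [/\ forall i : 'I_m,
        f (lshift n i) (u (lshift n i))
        = godunov (f (lshift n i)) (u (lshift n i)) p,
      forall j : 'I_n,
        f (rshift m j) (u (rshift m j))
        = godunov (f (rshift m j)) p (u (rshift m j)) &
      \sum_(i < m) godunov (f (lshift n i)) (u (lshift n i)) p
      = \sum_(j < n) godunov (f (rshift m j)) p (u (rshift m j))].

Definition admissible_solution rmax f (u0 : 'I_(m + n) -> R -> R) rho : Prop :=
  kruzhkov_inequalities rmax f u0 rho /\
  exists gamma : 'I_(m + n) -> R -> R,
    (forall h, is_trace rmax h (rho h) (gamma h)) /\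
    exists2 p : R -> R, Linfty Rplus rmax p &
      {ae mu, forall t, 0 <= t -> junction_condition f (gamma ^~ t) (p t)}.

Definition germ_VV rmax f : set ('I_(m + n) -> R) :=
  [set u | (forall h, u h \in `[0, rmax]) /\
           exists2 p, p \in `[0, rmax] & junction_condition f u p].

Definition self_similar rho : Prop :=
  forall h, exists v : R -> R,
    forall t x, 0 < t -> road h x -> rho h (t, x) = v (x / t).

End Junction.

(* Main.v *)
Require Import Defs.
From HB Require Import structures.
From mathcomp Require Import all_boot all_order all_algebra.
From mathcomp Require Import all_classical all_reals all_analysis.
From mathcomp Require Import measurable_realfun ring lra.
Import Order.TTheory GRing.Theory Num.Theory.
Import numFieldNormedType.Exports.
Local Open Scope classical_set_scope.
Local Open Scope ring_scope.
Set Implicit Arguments.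
Unset Strict Implicit.
Unset Printing Implicit Defensive.

(** Once the state p at the junction is chosen, the roads decouple. Road h
    carries the part, lying on its own half-line, of the solution of the Riemann
    problem between p and u0 h. Whatever p is, the trace g of this solution at
    the junction satisfies [f g = godunov f g p] (with the arguments exchanged
    on an outgoing road), and this flux is the Godunov flux between u0 h and p;
    so p only has to balance the Godunov fluxes computed with the data u0. The
    incoming minus the outgoing sum is Lipschitz in p, nonnegative at p = 0 and
    nonpositive at p = rmax, because f vanishes at both ends; the intermediate
    value theorem gives p ([junction_coupling]).

    The change of x into - x turns an incoming road into the half-line x > 0 and
    its flux f into - f. There remains a Lipschitz flux F on x > 0 with state a at
    the junction and datum b. Its self-similar solution [w (x / t)] is described
    without convex envelopes: w z minimizes (if a <= b) or maximizes (if b <= a)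
    [F s - z * s] over the s between a and b. Comparing the optimality
    conditions at two slopes shows that any such selection w is monotone, that it
    equals b as soon as z exceeds the Lipschitz constant, and that its right limit
    at 0 optimizes F itself; this last fact is what the junction condition asks
    of the trace.

    For the Kruzhkov inequality, put E z = |w z - k| and let Q z be the
    corresponding entropy flux. Optimality at slopes c <= d yields the discrete
    inequality Q d - Q c - c (E d - E c) <= (d - c) |w d - w c|
    ([entropy_increment]). For a test function phi let
    J c be the integral of phi along the ray x = c t. Over the sector 0 < x <= c t
    the integrals of the x- and t-derivatives of phi are J c and - c J c, hence
        H c = (integral of E phi_t + Q phi_x over the sector) - (Q c - c E c) J c
    satisfies H d - H c >= - C (d - c) |w d - w c|: inside the thin sector
    between the two rays, E and Q may be replaced by E d and Q d, with an error
    that is the area, of order d - c, times the variation of w. Because w is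
    monotone, their sum tends to 0 along finer and finer subdivisions
    ([partition_monotone]), so H Lam >= H 0 = 0. Beyond a slope Lam the solution
    is the constant datum, and H Lam is exactly the left-hand side of the Kruzhkov
    inequality ([quadrant_entropy_inequality]).

    Finally, two traces g1, g2 of the same function satisfy
    int xi |g1 - g2| = 0 for every nonnegative test function xi; a smooth bump
    that is positive on ]0, N[ then forces g1 = g2 almost everywhere, and the
    traces of the solution are the constants g found above. *)

(** * Riemann states of a scalar flux *)

Section RiemannState.
Context {R : realType}.
Implicit Types (F f : R -> R) (a b s p k K : R).

Definition lipschitz_between rmax K F : Prop :=
  forall x y, 0 <= x <= rmax -> 0 <= y <= rmax -> `|F x - F y| <= K * `|x - y|.

(** The values at speed 0 of the solution of the Riemann problem for F with left
    state a and right state b: minimizers of F over [a, b] or maximizers over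
    [b, a], as in the Godunov flux. For the flux [F s - z * s] seen from a frame
    moving at speed z, they are the values of that solution on the ray x = z t. *)
Definition riemann_state F a b s : Prop :=
  [/\ Num.min a b <= s <= Num.max a b,
      a <= b -> forall r, a <= r <= b -> F s <= F r &
      b <= a -> forall r, b <= r <= a -> F r <= F s].

Lemma riemann_state_ext F G a b s :
  (forall r, Num.min a b <= r <= Num.max a b -> F r = G r) ->
  riemann_state F a b s -> riemann_state G a b s.
Proof.
move=> FG [sab m M]; split=> // ab r rab; rewrite -!FG//.
- exact: m.
- by rewrite min_l// max_r.
- exact: M.
- by rewrite min_r// max_l.
Qed.

(** If rho solves the equation with flux F, then - rho solves the one with flux
    r |-> - F (- r). This exchanges the cases a <= b and b <= a. *)
Lemma riemann_state_opp F a b s :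
  riemann_state F a b s -> riemann_state (fun r => - F (- r)) (- a) (- b) (- s).
Proof.
case=> sab m M; split.
- by move: sab; rewrite -oppr_max -oppr_min !lerN2 andbC.
- rewrite lerN2 => ba r rab; rewrite opprK lerN2; apply: M => //.
  by rewrite lerNr andbC lerNl.
- rewrite lerN2 => ba r rab; rewrite opprK lerN2; apply: m => //.
  by rewrite lerNr andbC lerNl.
Qed.

Lemma flux_lipschitz rmax L f : 0 < rmax -> flux_condition rmax L f ->
  exists2 K, 0 < K & lipschitz_between rmax K f.
Proof.
move=> r0 [_ [M [_ HM]] _ _ _].
exists (`|M| + 1); first by rewrite ltr_wpDl.
move=> x y xr yr.
have MM : M < `|M| + 1 by rewrite (le_lt_trans (ler_norm _)) ?ltrDl.
by apply: (HM _ MM (x, y)); split; rewrite /= in_itv.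
Qed.

Lemma lipschitz_within rmax K F a b : 0 < K -> lipschitz_between rmax K F ->
  0 <= a -> b <= rmax -> {within `[a, b], continuous F}.
Proof.
move=> K0 lF a0 br; rewrite continuous_subspace_in => x /[!inE] /= xab.
have Ax : `[a, b]%classic x by rewrite /= in_itv.
apply/cvgrPdist_lt => e e0; rewrite -(nbhs_subspace_in Ax) near_withinE.
near=> y => yab.
have inr z : z \in `[a, b] -> 0 <= z <= rmax.
  rewrite in_itv/= => /andP[az zb].
  by rewrite (le_trans a0 az) (le_trans zb br).
apply: le_lt_trans (lF _ _ (inr _ xab) (inr _ yab)) _.
rewrite -ltr_pdivlMl//.
near: y; apply/nbhs_ballP; exists (K^-1 * e) => //=.
by rewrite mulr_gt0// invr_gt0.
Unshelve. all: by end_near. Qed.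

Lemma riemann_state_exists rmax K F a b : 0 < K -> lipschitz_between rmax K F ->
  0 <= a <= rmax -> 0 <= b <= rmax -> exists s, riemann_state F a b s.
Proof.
move=> K0 lF /andP[a0 ar] /andP[b0 br].
have [ab|ba] := leP a b.
  have [s + ms] := EVT_min ab (lipschitz_within K0 lF a0 br).
  rewrite in_itv/= => sab; exists s; split.
  - by rewrite min_l// max_r.
  - by move=> _ r rab; apply: ms; rewrite in_itv.
  - move=> ba r /andP[br' ra].
    have sr : s = r by lra.
    by rewrite sr.
have [s + ms] := EVT_max (ltW ba) (lipschitz_within K0 lF b0 ar).
rewrite in_itv/= => sab; exists s; split.
- by rewrite min_r ?max_l// ltW.
- by rewrite leNgt ba.
- by move=> _ r rab; apply: ms; rewrite in_itv.
Qed.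

(** The second equality is the stationarity required of a trace: s is optimal
    between a and b, hence also on the smaller interval between a and s. *)
Lemma godunov_riemann_state F a b s : riemann_state F a b s ->
  godunov F a b = F s /\ godunov F a s = F s.
Proof.
case=> sab m M; rewrite /godunov.
have inf_attained c d : c <= s <= d -> (forall r, c <= r <= d -> F s <= F r) ->
    inf [set F r | r in `[c, d]] = F s.
  move=> scd ms; apply/eqP; rewrite eq_le; apply/andP; split.
    apply: ge_inf; last by exists s => //=; rewrite in_itv.
    by exists (F s) => _ [r + <-]; rewrite /= in_itv/=; exact: ms.
  apply: lb_le_inf; first by exists (F s), s => //=; rewrite in_itv.
  by move=> _ [r + <-]; rewrite /= in_itv/=; exact: ms.
have sup_attained c d : c <= s <= d -> (forall r, c <= r <= d -> F r <= F s) ->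
    sup [set F r | r in `[c, d]] = F s.
  move=> scd ms; apply/eqP; rewrite eq_le; apply/andP; split.
    apply: ge_sup; first by exists (F s), s => //=; rewrite in_itv.
    by move=> _ [r + <-]; rewrite /= in_itv/=; exact: ms.
  apply: ub_le_sup; last by exists s => //=; rewrite in_itv.
  by exists (F s) => _ [r + <-]; rewrite /= in_itv/=; exact: ms.
have [ab|ba] := leP a b.
  move: sab; rewrite min_l// max_r// => /andP[as_ sb].
  rewrite as_ !inf_attained ?as_ ?lexx//; last exact: m.
  by move=> r /andP[ar rs]; apply: m => //; rewrite ar (le_trans rs).
move: sab; rewrite min_r ?max_l ?(ltW ba)// => /andP[bs sa].
rewrite sup_attained ?bs//; last by apply: M; exact: ltW.
split=> //; case: ifPn => [as_|_].
  have -> : s = a by apply/eqP; rewrite eq_le sa as_.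
  have -> : a = s by apply/eqP; rewrite eq_le sa as_.
  apply: inf_attained; rewrite ?lexx// => r /andP[sr rs].
  by have -> : r = s by apply/eqP; rewrite eq_le rs sr.
apply: sup_attained; rewrite ?lexx// => r /andP[sr ra].
by apply: M; rewrite ?(ltW ba)// ra (le_trans bs).
Qed.

(** Effect of the reflection x |-> - x: the two states are exchanged and the
    flux changes sign. *)
Lemma riemann_state_rev F a b s :
  riemann_state F a b s -> riemann_state (fun r => - F r) b a s.
Proof.
case=> sab m M; split; first by rewrite minC maxC.
- by move=> ba r rab; rewrite lerN2; exact: M.
- by move=> ab r rab; rewrite lerN2; exact: m.
Qed.

Lemma lipschitz_between_opp rmax K F : lipschitz_between rmax K F ->
  lipschitz_between rmax K (fun r => - F r).
Proof. by move=> lF x y xr yr; rewrite -opprD normrN lF. Qed.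

Lemma godunov_opp rmax K F a b : 0 < K -> lipschitz_between rmax K F ->
  0 <= a <= rmax -> 0 <= b <= rmax ->
  godunov F a b = - godunov (fun r => - F r) b a.
Proof.
move=> K0 lF ar br; have [s Fs] := riemann_state_exists K0 lF ar br.
have [-> _] := godunov_riemann_state Fs.
by have [-> _] := godunov_riemann_state (riemann_state_rev Fs); rewrite opprK.
Qed.

(** When x and y lie on the same side of b, one of the two intervals contains
    the other, and the optimum over the larger one moves by at most y - x when it
    is projected on the smaller one. When b separates x and y, the path from x to
    y is cut at b. *)
Lemma godunov_lipschitzl rmax K F b : 0 < K -> lipschitz_between rmax K F ->
  0 <= b <= rmax -> lipschitz_between rmax K (godunov F ^~ b).
Proof.
move=> K0 lF br.
have le_side x y : x <= y -> 0 <= x <= rmax -> 0 <= y <= rmax ->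
    (y <= b) || (b <= x) ->
    `|godunov F x b - godunov F y b| <= K * (y - x).
  move=> xy xr yr side.
  have [s Fs] := riemann_state_exists K0 lF xr br.
  have [s' Fs'] := riemann_state_exists K0 lF yr br.
  have [-> _] := godunov_riemann_state Fs.
  have [-> _] := godunov_riemann_state Fs'.
  case: Fs => sb ms Ms; case: Fs' => sb' ms' Ms'.
  case/orP: side => [yb|bx].
    have xb := le_trans xy yb.
    move: sb sb'; rewrite !min_l// !max_r// => /andP[xs sb] /andP[ys sb'].
    have Fss' := ms xb s'; have Fs's := ms' yb (Num.max s y).
    have lFs := lF (Num.max s y) s.
    rewrite sb' (le_trans xy ys) in Fss'; have {}Fss' := Fss' isT.
    have [sy|ys2] := leP s y.
      rewrite (max_r sy) lexx yb in Fs's lFs; have {}Fs's := Fs's isT.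
      have /andP[? ?] := xr; have /andP[? ?] := yr; have /andP[? ?] := br.
      have : `|F y - F s| <= K * `|y - s| by apply: lFs => //; lra.
      rewrite (ger0_norm (_ : 0 <= y - s)) ?subr_ge0// => /ler_normlP[h1 h2].
      have : K * (y - s) <= K * (y - x) by rewrite ler_pM2l// lerD2l lerN2.
      by move=> h3; apply/ler_normlP; split; lra.
    rewrite (max_l (ltW ys2)) sb (ltW ys2) in Fs's; have {}Fs's := Fs's isT.
    have h3 : 0 <= K * (y - x) by rewrite mulr_ge0 ?subr_ge0// ltW.
    by apply/ler_normlP; split; lra.
  have b_y := le_trans bx xy.
  move: sb sb'; rewrite !min_r// !max_l// => /andP[bs sx] /andP[bs' sy].
  have Fs's := Ms' b_y s; rewrite bs (le_trans sx xy) in Fs's.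
  have {}Fs's := Fs's isT.
  have [sx'|xs'] := leP s' x.
    have Fss' := Ms bx s'; rewrite bs' sx' in Fss'; have {}Fss' := Fss' isT.
    have h3 : 0 <= K * (y - x) by rewrite mulr_ge0 ?subr_ge0// ltW.
    by apply/ler_normlP; split; lra.
  have Fxs := Ms bx x; rewrite bx lexx in Fxs; have {}Fxs := Fxs isT.
  have /andP[? ?] := xr; have /andP[? ?] := yr; have /andP[? ?] := br.
  have : `|F s' - F x| <= K * `|s' - x| by apply: lF => //; lra.
  rewrite (ger0_norm (_ : 0 <= s' - x)) ?subr_ge0 ?(ltW xs')// => /ler_normlP[h1 h2].
  have : K * (s' - x) <= K * (y - x) by rewrite ler_pM2l// lerD2r.
  by move=> h3; apply/ler_normlP; split; lra.
have le_ord x y : x <= y -> 0 <= x <= rmax -> 0 <= y <= rmax ->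
    `|godunov F x b - godunov F y b| <= K * (y - x).
  move=> xy xr yr; have [side|] := boolP ((y <= b) || (b <= x)).
    exact: le_side.
  rewrite negb_or -!ltNge => /andP[b_y xb].
  have h1 := le_side x b (ltW xb) xr br; rewrite lexx in h1.
  have h2 := le_side b y (ltW b_y) br yr; rewrite lexx orbT in h2.
  have -> : y - x = (b - x) + (y - b) by ring.
  rewrite mulrDr; apply: le_trans (lerD (h1 isT) (h2 isT)).
  rewrite [X in `|X|](_ : _ = (godunov F x b - godunov F b b)
    + (godunov F b b - godunov F y b)); first exact: ler_normD.
  by ring.
move=> x y xr yr; have [xy|yx] := leP x y.
  by rewrite (distrC x) (ger0_norm (_ : 0 <= y - x)) ?subr_ge0//; exact: le_ord.
rewrite distrC (ger0_norm (_ : 0 <= x - y)) ?subr_ge0 ?(ltW yx)//.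
by apply: le_ord => //; exact: ltW.
Qed.

(** Optimizers need not be unique, but any choice of them gives the same
    solution up to countably many rays. *)
Definition self_similar_state F a b z : R :=
  xget a (riemann_state (fun r => F r - z * r) a b).

Lemma lipschitz_between_tilt rmax K F z : lipschitz_between rmax K F ->
  lipschitz_between rmax (K + `|z|) (fun r => F r - z * r).
Proof.
move=> lF x y xr yr; rewrite [X in `|X|](_ : _ = F x - F y - z * (x - y)); last by ring.
by rewrite (le_trans (ler_normB _ _))// mulrDl lerD ?lF// normrM.
Qed.

Lemma self_similar_stateP rmax K F a b z : 0 < K -> lipschitz_between rmax K F ->
  0 <= a <= rmax -> 0 <= b <= rmax ->
  riemann_state (fun r => F r - z * r) a b (self_similar_state F a b z).
Proof.
move=> K0 lF ar br; rewrite /self_similar_state; case: xgetP => // none.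
have Kz : 0 < K + `|z| by rewrite ltr_pwDl.
have [s Fs] := riemann_state_exists Kz (lipschitz_between_tilt z lF) ar br.
by have := none s.
Qed.

(** Adding the optimality of s at slope z, tested against s', to that of s' at
    slope z', tested against s, leaves 0 <= (z' - z) (s' - s). *)
Lemma riemann_state_le F a b z z' s s' : a <= b -> z < z' ->
  riemann_state (fun r => F r - z * r) a b s ->
  riemann_state (fun r => F r - z' * r) a b s' -> s <= s'.
Proof.
move=> ab zz' [+ m _] [+ m' _]; rewrite min_l// max_r// => sab sab'.
have := m ab _ sab'; have := m' ab _ sab => h1 h2.
by rewrite -(ler_pM2l (_ : 0 < z' - z)) ?subr_gt0//; lra.
Qed.

Lemma riemann_state_ge F a b z z' s s' : b <= a -> z < z' ->
  riemann_state (fun r => F r - z * r) a b s ->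
  riemann_state (fun r => F r - z' * r) a b s' -> s' <= s.
Proof.
move=> ba zz' [+ _ m] [+ _ m']; rewrite min_r// max_l// => sab sab'.
have := m ba _ sab'; have := m' ba _ sab => h1 h2.
by rewrite -(ler_pM2l (_ : 0 < z' - z)) ?subr_gt0//; lra.
Qed.

(** Above the Lipschitz constant of F, [F s - z * s] is strictly decreasing in
    s, so that its optimum is at the end b: waves travel at finite speed. *)
Lemma riemann_state_far rmax K F a b z s : lipschitz_between rmax K F ->
  0 <= a <= rmax -> 0 <= b <= rmax -> K < z ->
  riemann_state (fun r => F r - z * r) a b s -> s = b.
Proof.
move=> lF ar br Kz [sab m M].
have sr : 0 <= s <= rmax.
  by move: sab ar br; rewrite ge_min le_max => /andP[] /orP[] ? /orP[] ? /andP[? ?] /andP[? ?]; lra.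
have := lF s b sr br => lFs.
have [ab|ba] := leP a b.
  have /m := ab; rewrite min_l// max_r// in sab => /(_ b).
  rewrite ab lexx => /(_ isT) h.
  case/andP: sab => as_ sb.
  rewrite (distrC s) (ger0_norm (_ : 0 <= b - s)) ?subr_ge0// in lFs.
  have /ler_normlP[h1 h2] := lFs.
  have h3 : (z - K) * (b - s) <= 0 by lra.
  have : b - s <= 0 by rewrite -(ler_pM2l (_ : 0 < z - K)) ?subr_gt0// mulr0.
  by move=> ?; lra.
have /M := ltW ba; rewrite min_r ?max_l ?(ltW ba)// in sab => /(_ b).
rewrite lexx (ltW ba) => /(_ isT) h.
case/andP: sab => bs sa.
rewrite (ger0_norm (_ : 0 <= s - b)) ?subr_ge0// in lFs.
have /ler_normlP[h1 h2] := lFs.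
have h3 : (z - K) * (s - b) <= 0 by lra.
have : s - b <= 0 by rewrite -(ler_pM2l (_ : 0 < z - K)) ?subr_gt0// mulr0.
by move=> ?; lra.
Qed.

Lemma kruzhkov_lipschitz rmax K F k u v : lipschitz_between rmax K F ->
  0 <= k <= rmax -> 0 <= u <= rmax -> 0 <= v <= rmax ->
  `|kruzhkov F u k - kruzhkov F v k| <= K * `|u - v|.
Proof.
move=> lF kr.
wlog uv : u v / u <= v => [wl ur vr|ur vr].
  have [uv|vu] := leP u v; first exact: wl.
  by rewrite distrC (distrC u); apply: wl => //; exact: ltW.
rewrite (distrC u) (ger0_norm (_ : 0 <= v - u)) ?subr_ge0//.
have := lF u k ur kr; have := lF v k vr kr; have := lF u v ur vr.
rewrite (distrC u v) (ger0_norm (_ : 0 <= v - u)) ?subr_ge0// /kruzhkov.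
move=> /ler_normlP[a1 a2] h2 h3; apply/ler_normlP.
have [uk|ku|uk] := ltgtP u k.
- rewrite (ltr0_norm (_ : u - k < 0)) ?subr_lt0// in h3; move/ler_normlP: h3 => [b1 b2].
  rewrite (ltr0_sg (_ : u - k < 0)) ?subr_lt0//.
  have [vk|kv|vk] := ltgtP v k.
  + by rewrite ltr0_sg ?subr_lt0//; split; lra.
  + rewrite (gtr0_norm (_ : 0 < v - k)) ?subr_gt0// in h2; move/ler_normlP: h2 => [c1 c2].
    by rewrite gtr0_sg ?subr_gt0//; split; lra.
  + by subst v; rewrite !subrr sgr0; split; lra.
- have kv := lt_le_trans ku uv.
  by rewrite !gtr0_sg ?subr_gt0//; split; lra.
- subst u; rewrite !subrr sgr0.
  move: uv; rewrite le_eqVlt => /predU1P[<-|kv].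
    by rewrite subrr sgr0; split; lra.
  by rewrite gtr0_sg ?subr_gt0//; split; lra.
Qed.

(** The sign of s - k and s' - k decides which of the optimality conditions is
    used. If k does not separate s and s', the estimate compares F s and F s'; if
    it does, both values are compared with F k, the one at s with slope c and the
    one at s' with slope d, and the error term pays for the change of slope. *)
Lemma entropy_step F k c d s s' : c <= d -> s <= s' ->
  (s <= k <= s' -> F s' - d * s' <= F k - d * k) ->
  (s <= k <= s' -> F s - c * s <= F k - c * k) ->
  F s' - d * s' <= F s - d * s -> F s - c * s <= F s' - c * s' ->
  kruzhkov F s' k - kruzhkov F s k - c * (`|s' - k| - `|s - k|)
  <= (d - c) * (s' - s).
Proof.
move=> cd ss' h1 h2 h3 h4; rewrite /kruzhkov.
have [sk|ks|sk] := ltgtP s k.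
- rewrite (ltr0_sg (_ : s - k < 0)) ?subr_lt0//.
  rewrite (ltr0_norm (_ : s - k < 0)) ?subr_lt0//.
  have [sk'|ks'|sk'] := ltgtP s' k.
  + rewrite ltr0_sg ?subr_lt0// ltr0_norm ?subr_lt0//.
    have : 0 <= (d - c) * (s' - s) by rewrite mulr_ge0// subr_ge0.
    by move=> ?; lra.
  + rewrite gtr0_sg ?subr_gt0// gtr0_norm ?subr_gt0//.
    rewrite (ltW sk) (ltW ks') in h1 h2; have := h1 isT; have := h2 isT.
    have : (d - c) * (s' - k) <= (d - c) * (s' - s).
      by apply: ler_wpM2l; rewrite ?subr_ge0// lerD2l lerN2 ltW.
    by move=> ? ? ?; lra.
  + subst s'; rewrite !subrr sgr0 normr0.
    have : 0 <= (d - c) * (k - s) by rewrite mulr_ge0// subr_ge0// ltW.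
    by move=> ?; lra.
- have ks' := lt_le_trans ks ss'.
  rewrite !gtr0_sg ?subr_gt0// !gtr0_norm ?subr_gt0//; lra.
- subst s; rewrite !subrr sgr0 normr0.
  move: ss'; rewrite le_eqVlt => /predU1P[<-|ks'].
    by rewrite !subrr sgr0 normr0; lra.
  by rewrite gtr0_sg ?subr_gt0// gtr0_norm ?subr_gt0//; lra.
Qed.

Lemma kruzhkov_opp F u k : kruzhkov (fun r => - F (- r)) (- u) (- k) = kruzhkov F u k.
Proof. by rewrite /kruzhkov -opprD sgrN !opprK mulNr -mulrN opprD opprK. Qed.

(** Discrete form of the self-similar entropy inequality dQ <= z dE, with an
    error of second order, the mesh times the variation of the state. *)
Lemma entropy_increment F a b k c d s s' : c < d ->
  riemann_state (fun r => F r - c * r) a b s ->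
  riemann_state (fun r => F r - d * r) a b s' ->
  kruzhkov F s' k - kruzhkov F s k - c * (`|s' - k| - `|s - k|)
  <= (d - c) * `|s' - s|.
Proof.
move=> cd.
wlog ab : F a b k s s' / a <= b.
  move=> wl Fs Fs'; have [ab|ba] := leP a b.
    exact: (wl _ _ _ _ _ _ ab Fs Fs').
  have tilt z r : - (F (- r) - z * - r) = - F (- r) - z * r by ring.
  have := wl (fun r => - F (- r)) (- a) (- b) (- k) (- s) (- s').
  rewrite lerN2 (ltW ba) !kruzhkov_opp -!opprD !normrN.
  apply=> //.
  - by apply: riemann_state_ext (riemann_state_opp Fs) => r _; rewrite tilt.
  - by apply: riemann_state_ext (riemann_state_opp Fs') => r _; rewrite tilt.
move=> Fs Fs'; have ss' := riemann_state_le ab cd Fs Fs'.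
case: Fs Fs' => sab m _ [sab' m' _].
rewrite min_l// max_r// in sab sab'.
rewrite (ger0_norm (_ : 0 <= s' - s)) ?subr_ge0//.
case/andP: (sab) => as_ sb; case/andP: (sab') => as' sb'.
apply: entropy_step => //; first exact: ltW.
- by move=> /andP[? ?]; apply: m' => //; lra.
- by move=> /andP[? ?]; apply: m => //; lra.
- exact: m'.
- exact: m.
Qed.

End RiemannState.

(** * Integrals of compactly supported bounded functions on the plane *)

Section PlaneIntegrals.
Context {R : realType}.
Local Notation mu := (@lebesgue_measure R).
Local Notation mu2 := (mu \x mu)%E.
Implicit Types (g h : R * R -> R).

Lemma nbhs_rat_itv (y : R) (C : set R) : nbhs y C -> exists p : rat * rat,
  (y \in `](ratr p.1), (ratr p.2)[) /\ (`](ratr p.1), (ratr p.2)[%classic `<=` C).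
Proof.
move=> /nbhs_ballP[e /= e0 eC].
have [|a] := @rat_in_itvoo R (y - e) y; first by rewrite ltrBlDr ltrDl.
rewrite in_itv/= => /andP[a1 a2].
have [|b] := @rat_in_itvoo R y (y + e); first by rewrite ltrDl.
rewrite in_itv/= => /andP[b1 b2].
exists (a, b); split; first by rewrite /= in_itv/= a2 b1.
move=> z /=; rewrite in_itv/= => /andP[az zb]; apply: eC.
by rewrite /ball/= ltr_distlC (lt_trans a1 az) (lt_trans zb b2).
Qed.

(** The product sigma-algebra contains the open sets because the rational boxes
    form a countable base. *)
Lemma open_measurable_plane (U : set (R * R)) : open U -> measurable U.
Proof.
move=> oU.
pose box (q : rat * rat * (rat * rat)) : set (R * R) :=
  `](ratr q.1.1), (ratr q.1.2)[%classic `*` `](ratr q.2.1), (ratr q.2.2)[%classic.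
have -> : U = \bigcup_q (if `[< box q `<=` U >] then box q else set0).
  apply/seteqP; split => [[t x] Utx|z [q _]]; last by case: asboolP => // + qz; apply.
  have [[A B] /= [At Bx] AB] := open_nbhs_nbhs (conj oU Utx).
  have [p [pt pA]] := nbhs_rat_itv At; have [q [qx qB]] := nbhs_rat_itv Bx.
  exists (p, q) => //; case: asboolP => [_|]; first by split.
  by case => -[s y] [/= ps qy]; apply: AB; split; [exact: pA|exact: qB].
apply: countable_bigcupT_measurable; first exact: countableP.
by move=> q; case: asboolP => // _; apply: measurableX.
Qed.

Lemma continuous_measurable_plane g : continuous g -> measurable_fun setT g.
Proof.
move=> cg; apply: (measurability _ (RGenOpens.measurableE R)).
move=> _ [_ [a [b ->] <-]]; rewrite setTI.
by apply: open_measurable_plane; apply: open_comp => // + _; exact: cg.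
Qed.

Lemma measurable_inv : measurable_fun [set: R] (fun x : R => x^-1).
Proof.
have -> : [set: R] = `]-oo, 0[ `|` (`]0, +oo[ `|` [set 0]).
  apply/seteqP; split=> // x _; have [x0|x0|->] := ltgtP x 0; [left|right; left|right; right] => //=.
  by rewrite in_itv/= x0.
apply/measurable_funU => //; first exact: measurableU.
split.
  apply: open_continuous_measurable_fun => // x; rewrite inE/= in_itv/= => x0.
  by apply: inv_continuous; rewrite lt_eqF.
apply/measurable_funU => //; split.
  apply: open_continuous_measurable_fun => // x; rewrite inE/= in_itv/= andbT => x0.
  by apply: inv_continuous; rewrite gt_eqF.
exact: measurable_fun_set1.
Qed.

(** A class of integrable functions that is stable under sections, products with
    bounded functions and linear combinations, so that no integrability has to be
    discussed when Fubini's theorem is used. *)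
Definition box_bounded1 (h : R -> R) : Prop :=
  [/\ measurable_fun setT h, (exists M, forall x, `|h x| <= M) &
      (exists T, forall x, T < `|x| -> h x = 0)].

Definition box_bounded g : Prop :=
  [/\ measurable_fun setT g, (exists M, forall z, `|g z| <= M) &
      (exists T, forall t x, T < `|t| \/ T < `|x| -> g (t, x) = 0)].

Lemma box_bounded1_integrable (h : R -> R) : box_bounded1 h ->
  mu.-integrable setT (EFin \o h).
Proof.
move=> [mh [M hM] [T hT]].
have -> : EFin \o h = (EFin \o h) \_ `[- T, T].
  apply/funext => x /=; rewrite patchE; case: ifPn => //.
  rewrite notin_setE/= in_itv/= -ler_norml => /negP; rewrite -ltNge => Tx.
  by rewrite hT.
apply/integrable_restrict => //; rewrite setTI.
apply: measurable_bounded_integrable => //.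
- by rewrite /= lebesgue_measure_itv/=; case: ifPn => // _; rewrite -EFinB ltry.
- exact: measurable_funTS.
- exists M; split; first exact: num_real.
  by move=> N MN x _ /=; rewrite (le_trans (hM x))// ltW.
Qed.

Lemma box_bounded_integrable g : box_bounded g ->
  mu2.-integrable setT (EFin \o g).
Proof.
move=> [mg [M gM] [T gT]].
pose B : set (R * R) := `[- T, T]%classic `*` `[- T, T]%classic.
have mB : measurable B by exact: measurableX.
have -> : EFin \o g = (EFin \o g) \_ B.
  apply/funext => -[t x] /=; rewrite patchE; case: ifPn => //.
  rewrite notin_setE/= => /not_andP[]; rewrite /= in_itv/= -ler_norml => /negP;
    rewrite -ltNge => Tx; rewrite gT//; [by left|by right].
apply/integrable_restrict => //; rewrite setTI.
apply: measurable_bounded_integrable => //.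
- rewrite [X in (X < _)%E](product_measure1E mu mu)//= lebesgue_measure_itv/=.
  by case: ifPn => // _; rewrite ?mule0// -EFinB -EFinM ltry.
- exact: measurable_funTS.
- exists M; split; first exact: num_real.
  by move=> N MN x _ /=; rewrite (le_trans (gM x))// ltW.
Qed.

Lemma box_bounded_sectionl g t : box_bounded g ->
  box_bounded1 (fun x => g (t, x)).
Proof.
move=> [mg [M gM] [T gT]]; split.
- exact: measurableT_comp.
- by exists M => x.
- by exists T => x Tx; rewrite gT//; right.
Qed.

Lemma box_bounded_sectionr g x : box_bounded g ->
  box_bounded1 (fun t => g (t, x)).
Proof.
move=> [mg [M gM] [T gT]]; split.
- exact: measurableT_comp.
- by exists M => t.
- by exists T => t Tt; rewrite gT//; left.
Qed.

Lemma Rintegral_EFin (h : R -> R) : box_bounded1 h ->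
  (\int[mu]_x (h x)%:E)%E = (\int[mu]_x h x)%:E.
Proof.
move=> ch; rewrite /Rintegral fineK//.
exact: integrable_fin_num (box_bounded1_integrable ch).
Qed.

Lemma plane_integral_EFin g : box_bounded g ->
  (\int[mu2]_z (g z)%:E)%E = (\int[mu2]_z g z)%:E.
Proof.
move=> cg; rewrite /Rintegral fineK//.
exact: integrable_fin_num (box_bounded_integrable cg).
Qed.

Lemma iterated_integral g : box_bounded g ->
  (\int[mu]_t \int[mu]_x (g (t, x))%:E)%E = (\int[mu2]_z g z)%:E.
Proof.
move=> cg; rewrite -plane_integral_EFin// -integral12_prod_meas1//.
exact: box_bounded_integrable.
Qed.

Lemma Rintegral_tx g : box_bounded g ->
  \int[mu2]_z g z = \int[mu]_t \int[mu]_x g (t, x).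
Proof.
move=> cg; apply: EFin_inj; rewrite -iterated_integral//.
rewrite /Rintegral fineK; last first.
  rewrite (_ : (fun _ => _) = (fun t => \int[mu]_x (g (t, x))%:E)%E); last first.
    by apply/funext => t; rewrite Rintegral_EFin//; exact: box_bounded_sectionl.
  by rewrite iterated_integral.
by apply: eq_integral => t _; rewrite Rintegral_EFin//; exact: box_bounded_sectionl.
Qed.

Lemma Rintegral_xt g : box_bounded g ->
  \int[mu2]_z g z = \int[mu]_x \int[mu]_t g (t, x).
Proof.
move=> cg; have ig := box_bounded_integrable cg.
apply: EFin_inj; rewrite -plane_integral_EFin// -integral21_prod_meas1//.
rewrite /Rintegral fineK; last first.
  rewrite (_ : (fun _ => _) = (fun x => \int[mu]_t (g (t, x))%:E)%E); last first.
    by apply/funext => t; rewrite Rintegral_EFin//; exact: box_bounded_sectionr.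
  rewrite [X in X \is a _](integral21_prod_meas1 ig).
  exact: integrable_fin_num.
by apply: eq_integral => t _; rewrite /fubini_G/= Rintegral_EFin//; exact: box_bounded_sectionr.
Qed.

Lemma box_boundedM (g h : R * R -> R) : box_bounded g -> measurable_fun setT h ->
  (exists M, forall z, `|h z| <= M) -> box_bounded (fun z => h z * g z).
Proof.
move=> [mg [M gM] [T gT]] mh [N hN]; split.
- exact: measurable_funM.
- by exists (N * M) => z; rewrite normrM ler_pM.
- by exists T => t x /gT ->; rewrite mulr0.
Qed.

Lemma box_boundedD g h : box_bounded g -> box_bounded h ->
  box_bounded (fun z => g z + h z).
Proof.
move=> [mg [M gM] [T gT]] [mh [N hN] [S hS]]; split.
- exact: measurable_funD.
- by exists (M + N) => z; rewrite (le_trans (ler_normD _ _))// lerD.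
- exists (Num.max T S) => t x; rewrite !gt_max => tx.
  by rewrite gT ?hS ?addr0//; case: tx => /andP[]; by [left|right].
Qed.

Lemma box_boundedZ g k : box_bounded g ->
  box_bounded (fun z => k * g z).
Proof. by move=> cg; apply: box_boundedM => //; exists `|k|. Qed.

Lemma plane_integralD g h : box_bounded g -> box_bounded h ->
  \int[mu2]_z (g z + h z) = \int[mu2]_z g z + \int[mu2]_z h z.
Proof. by move=> cg ch; apply: RintegralD => //; exact: box_bounded_integrable. Qed.

Lemma plane_integralZ g k : box_bounded g ->
  \int[mu2]_z (k * g z) = k * \int[mu2]_z g z.
Proof. by move=> cg; apply: RintegralZl => //; exact: box_bounded_integrable. Qed.

Lemma le_plane_integral g h : box_bounded g -> box_bounded h ->
  (forall z, g z <= h z) -> \int[mu2]_z g z <= \int[mu2]_z h z.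
Proof.
by move=> cg ch gh; apply: le_Rintegral => // *; exact: box_bounded_integrable.
Qed.

End PlaneIntegrals.

(** * Half-line integrals *)

Section Sectors.
Context {R : realType}.
Local Notation mu := (@lebesgue_measure R).
Local Notation mu2 := (mu \x mu)%E.

Lemma measurable_natr_bool d (T : measurableType d) (p : T -> bool) :
  measurable_fun setT p -> measurable_fun setT (fun z => (p z)%:R : R).
Proof.
move=> mp; apply: (measurableT_comp (f := fun b : bool => b%:R : R)) => //.
Qed.

Lemma box_bounded_indicator (p : R * R -> bool) (g : R * R -> R) :
  measurable_fun setT p -> box_bounded g ->
  box_bounded (fun z => (p z)%:R * g z).
Proof.
move=> mp cg; apply: box_boundedM => //; first exact: measurable_natr_bool.
by exists 1 => z; case: (p z); rewrite ?normr1 ?normr0.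
Qed.

Lemma continuous_box_bounded (g : R * R -> R) T : continuous g ->
  (forall t x, T < `|t| \/ T < `|x| -> g (t, x) = 0) -> box_bounded g.
Proof.
move=> cg gT; split; [exact: continuous_measurable_plane| |by exists T].
have cB : compact (`[- T, T]%classic `*` `[- T, T]%classic).
  by apply: compact_setX; exact: segment_compact.
have /compact_bounded[M [_ MM]] := continuous_compact (continuous_subspaceT cg) cB.
exists (`|M| + 1) => -[t x].
have [[tT xT]|] := pselect (`|t| <= T /\ `|x| <= T).
  apply: MM; first by rewrite (le_lt_trans (ler_norm _)) ?ltrDl.
  by exists (t, x) => //; split; rewrite /= in_itv/= -ler_norml.
move=> /not_andP[] /negP; rewrite -ltNge => h.
  by rewrite gT ?normr0//; left.
by rewrite gT ?normr0//; right.
Qed.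

(** Since h vanishes at infinity, this is the fundamental theorem of calculus on
    [a, b] for any b beyond the support. *)
Lemma FTC_half_line (h h' : R -> R) (T a : R) : continuous h' ->
  (forall x : R, is_derive x 1 h (h' x)) ->
  (forall x, T < x -> h x = 0 /\ h' x = 0) ->
  \int[mu]_x ((a <= x)%R%:R * h' x) = - h a.
Proof.
move=> ch' hh' hT; pose b := Num.max T a + 1.
have ab : a < b by rewrite ltr_pwDr// le_max lexx orbT.
have Tb : T < b by rewrite ltr_pwDr// le_max lexx.
have [hb _] := hT b Tb.
rewrite [LHS](_ : _ = \int[mu]_(x in `[a, b]) h' x); last first.
  rewrite [RHS]Rintegral_mkcond; apply: eq_Rintegral => x _.
  rewrite patchE; have [|] := boolP (x \in `[a, b]%classic).
    by rewrite inE/= in_itv/= => /andP[-> _]; rewrite mul1r.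
  rewrite notin_setE/= in_itv/= => /negP; rewrite negb_and => /orP[/negbTE->|].
    by rewrite mul0r.
  by rewrite -ltNge => bx; rewrite (hT _ (lt_trans Tb bx)).2 mulr0.
rewrite /Rintegral (continuous_FTC2 ab (F := h)) ?hb.
- by rewrite -EFinB/= sub0r.
- exact: continuous_subspaceT.
- have ch x : h y @[y --> x] --> h x.
    by apply: differentiable_continuous; apply/derivable1_diffP; case: (hh' x).
  split=> [x _| |]; first by case: (hh' x).
  + exact: cvg_at_right_filter.
  + exact: cvg_at_left_filter.
- by move=> x _; rewrite derive1E; apply: derive_val.
Qed.

Lemma Rintegral_half_line_open (h : R -> R) a : box_bounded1 h ->
  \int[mu]_x ((a < x)%R%:R * h x) = \int[mu]_x ((a <= x)%R%:R * h x).
Proof.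
move=> bh; have ih := box_bounded1_integrable bh.
rewrite [LHS](_ : _ = \int[mu]_(x in `]a, +oo[) h x); last first.
  rewrite [RHS]Rintegral_mkcond; apply: eq_Rintegral => x _.
  rewrite patchE mem_setE in_itv/= andbT.
  by case: ifPn => _; rewrite ?mul1r ?mul0r.
rewrite [RHS](_ : _ = \int[mu]_(x in `[a, +oo[) h x); last first.
  rewrite [RHS]Rintegral_mkcond; apply: eq_Rintegral => x _.
  rewrite patchE mem_setE in_itv/= andbT.
  by case: ifPn => _; rewrite ?mul1r ?mul0r.
by rewrite Rintegral_itv_obnd_cbnd//; apply: integrableS ih.
Qed.

Lemma Rintegral_scale (g : R -> R) (T c : R) : 0 < c -> continuous g ->
  (forall x, T < x -> g x = 0) ->
  \int[mu]_x ((0 < x)%R%:R * g (x / c)) = c * \int[mu]_x ((0 < x)%R%:R * g x).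
Proof.
move=> c0 cg gT; pose b := Num.max T 0 + 1.
have b0 : 0 < b by rewrite ltr_pwDr// le_max lexx orbT.
have Tb : T < b by rewrite ltr_pwDr// le_max lexx.
have itv (k : R -> R) e : 0 < e -> continuous k -> (forall x, e < x -> k x = 0) ->
    \int[mu]_x ((0 < x)%R%:R * k x) = \int[mu]_(x in `[0, e]) k x.
  move=> e0 ck kb; rewrite [LHS](_ : _ = \int[mu]_(x in `]0, e]) k x); last first.
    rewrite [RHS]Rintegral_mkcond; apply: eq_Rintegral => x _.
    rewrite patchE; have [|] := boolP (x \in `]0, e]%classic).
      by rewrite inE/= in_itv/= => /andP[-> _]; rewrite mul1r.
    rewrite notin_setE/= in_itv/= => /negP; rewrite negb_and => /orP[/negbTE->|].
      by rewrite mul0r.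
    by rewrite -ltNge => bx; rewrite kb// mulr0.
  rewrite Rintegral_itv_obnd_cbnd//.
  have ik : mu.-integrable `[0, e] (EFin \o k).
    apply: continuous_compact_integrable; first exact: segment_compact.
    exact: continuous_subspaceT.
  by apply: integrableS ik => //; exact: subset_itv_oc_cc.
rewrite (itv g b)//; last by move=> x bx; apply: gT; exact: lt_trans Tb bx.
rewrite (itv (fun x => g (x / c)) (c * b)) ?mulr_gt0//; first last.
- move=> x cbx; apply: gT; apply: lt_trans Tb _.
  by rewrite ltr_pdivlMr// mulrC.
- by move=> x; apply: continuous_comp; [exact: mulrr_continuous|exact: cg].
pose F : R -> R := fun x => c * x.
have dc (x : R) : is_derive x 1 F c.
  by rewrite -[X in is_derive _ _ _ X]mulr1; apply: is_deriveZ.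
have dcE : F^`()%classic = cst c.
  by apply/funext => x; rewrite derive1E; apply: derive_val.
have := @integration_by_substitution_increasing R F (fun x => g (x / c)) 0 b (ltW b0).
rewrite /F mulr0 -/F /Rintegral => ->.
- have ig : mu.-integrable `[0, b] (EFin \o g).
    apply: continuous_compact_integrable; first exact: segment_compact.
    exact: continuous_subspaceT.
  rewrite -[RHS](RintegralZl c _ ig)//.
  congr fine; apply: eq_integral => x _.
  by rewrite /= !fctE dcE/= mulrC /F mulrAC divff ?mul1r ?gt_eqF.
- by move=> x y _ _ xy; rewrite ltr_pM2l.
- by rewrite dcE => x _; exact: cvg_cst.
- by rewrite dcE; exact: is_cvg_cst.
- by rewrite dcE; exact: is_cvg_cst.
- split.
  + by move=> x _; case: (dc x).
  + by apply: cvg_at_right_filter; exact: mulrl_continuous.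
  + by apply: cvg_at_left_filter; exact: mulrl_continuous.
- apply: continuous_subspaceT => x.
  by apply: continuous_comp; [exact: mulrr_continuous|exact: cg].
Qed.

Lemma Rintegral_indicator_itv a b : a <= b ->
  \int[mu]_x ((a < x <= b)%R%:R) = b - a.
Proof.
move=> ab; rewrite [LHS](_ : _ = \int[mu]_(x in `]a, b]) 1); last first.
  rewrite [RHS]Rintegral_mkcond; apply: eq_Rintegral => x _.
  by rewrite patchE mem_setE in_itv/=; case: ifPn.
rewrite Rintegral_cst//= lebesgue_measure_itv/= lte_fin mul1r.
by case: ifPn => //=; rewrite -leNgt => ba; apply/esym/eqP; rewrite subr_eq0 eq_le ab ba.
Qed.

(** Slabs 0 < t <= S serve as integrable majorants in the time variable. *)
Lemma slab_box (S k : R) : box_bounded1 (fun t : R => (0 < t <= S)%R%:R * k).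
Proof.
split.
- apply: measurable_funM => //; apply: measurable_natr_bool; apply: measurable_and.
  + exact: measurable_fun_ltr.
  + exact: measurable_fun_ler.
- exists `|k| => t; rewrite normrM.
  by case: (_ && _); rewrite ?normr1 ?mul1r ?normr0 ?mul0r.
- exists S => t St; have [/andP[t0 tS]|_] := boolP (0 < t <= S); last by rewrite mul0r.
  by move: St; rewrite gtr0_norm// ltNge tS.
Qed.

Lemma slab_integral (S k : R) : 0 <= S ->
  \int[mu]_t ((0 < t <= S)%R%:R * k) = S * k.
Proof.
move=> S0; rewrite RintegralZr//; last first.
  have := box_bounded1_integrable (slab_box S 1).
  by apply: eq_integrable => // t _; rewrite /= mulr1.
by rewrite Rintegral_indicator_itv// subr0.
Qed.

Lemma half_line_box (h : R -> R) (a : R) : box_bounded1 h ->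
  box_bounded1 (fun x => (a < x)%R%:R * h x).
Proof.
move=> [mh [M hM] [S hS]]; split.
- by apply: measurable_funM => //; apply: measurable_natr_bool; exact: measurable_fun_ltr.
- exists M => x; rewrite normrM; apply: le_trans (hM x).
  by case: (a < x); rewrite ?normr1 ?mul1r ?normr0 ?mul0r.
- by exists S => x /hS ->; rewrite mulr0.
Qed.
End Sectors.

(** * The entropy inequality on a quadrant *)

Section EntropyInequality.
Context {R : realType}.
Local Notation mu := (@lebesgue_measure R).
Local Notation mu2 := (mu \x mu)%E.

(** What the entropy inequality uses of a test function: phit and phix are its
    partial derivatives, and [-T, T]^2 contains its support. They are kept as
    separate data so that the reflection in x acts on them. *)
Record C1_box (phi phit phix : R * R -> R) (T : R) : Prop := {
  c1_cont : continuous phi;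
  c1_contt : continuous phit;
  c1_contx : continuous phix;
  c1_dert : forall t x : R, is_derive t 1 (fun s => phi (s, x)) (phit (t, x));
  c1_derx : forall t x : R, is_derive x 1 (fun y => phi (t, y)) (phix (t, x));
  c1_supp : forall t x, T < `|t| \/ T < `|x| -> phi (t, x) = 0;
  c1_suppt : forall t x, T < `|t| \/ T < `|x| -> phit (t, x) = 0;
  c1_suppx : forall t x, T < `|t| \/ T < `|x| -> phix (t, x) = 0 }.

Definition quadrant (z : R * R) : bool := (0 < z.1) && (0 < z.2).
Definition sector (c : R) (z : R * R) : bool := (0 < z.1) && (0 < z.2 <= c * z.1).

Lemma measurable_quadrant : measurable_fun setT quadrant.
Proof.
apply: measurable_and; apply: measurable_fun_ltr => //.
Qed.

Lemma measurable_sector c : measurable_fun setT (sector c).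
Proof.
apply: measurable_and; first exact: measurable_fun_ltr.
apply: measurable_and; first exact: measurable_fun_ltr.
by apply: measurable_fun_ler => //; apply: measurable_funM.
Qed.

Variables (phi phit phix : R * R -> R) (T : R).
Hypothesis phiC1 : C1_box phi phit phix T.

Let bphi : box_bounded phi := continuous_box_bounded (c1_cont phiC1) (c1_supp phiC1).
Let bphit : box_bounded phit := continuous_box_bounded (c1_contt phiC1) (c1_suppt phiC1).
Let bphix : box_bounded phix := continuous_box_bounded (c1_contx phiC1) (c1_suppx phiC1).

(** Time-parametrized integral of phi along the ray of speed c. *)
Definition ray_integral (c : R) : R := \int[mu]_t ((0 < t)%R%:R * phi (t, c * t)).

Let continuous_pair (f g : R -> R) : continuous f -> continuous g ->
  continuous (fun t : R => (f t, g t)).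
Proof.
move=> cf cg t.
exact: (@cvg_pair _ _ _ (nbhs t) (nbhs (f t)) (nbhs (g t)) _ _ _ f g (cf t) (cg t)).
Qed.

Let continuous_ray (c : R) : continuous (fun t : R => phi (t, c * t)).
Proof.
move=> t; apply: (continuous_comp (f := fun t : R => (t, c * t))); last exact: (c1_cont phiC1).
by apply: continuous_pair => x; [exact: cvg_id|exact: mulrl_continuous].
Qed.

Let ray_box (c : R) : box_bounded1 (fun t => (0 < t)%R%:R * phi (t, c * t)).
Proof.
have [_ [M HM] _] := bphi; split.
- apply: measurable_funM; last exact: continuous_measurable_fun.
  by apply: measurable_natr_bool; exact: measurable_fun_ltr.
- exists M => t; rewrite normrM; apply: le_trans (HM (t, c * t)).
  by case: (0 < t); rewrite ?normr1 ?mul1r ?normr0 ?mul0r.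
- by exists T => t Tt; rewrite (c1_supp phiC1) ?mulr0//; left.
Qed.

Let dx_half_line t a : \int[mu]_x ((a <= x)%R%:R * phix (t, x)) = - phi (t, a).
Proof.
apply: (@FTC_half_line _ (fun x => phi (t, x)) (fun x => phix (t, x)) T).
- move=> x; apply: (continuous_comp (f := fun x : R => (t, x))); last exact: (c1_contx phiC1).
  by apply: continuous_pair => y; [exact: cvg_cst|exact: cvg_id].
- exact: (c1_derx phiC1).
- move=> x Tx; have Tx' : T < `|x| := lt_le_trans Tx (ler_norm x).
  by rewrite (c1_supp phiC1) ?(c1_suppx phiC1)//; right.
Qed.

Let dt_half_line x a : \int[mu]_t ((a <= t)%R%:R * phit (t, x)) = - phi (a, x).
Proof.
apply: (@FTC_half_line _ (fun t => phi (t, x)) (fun t => phit (t, x)) T).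
- move=> t; apply: (continuous_comp (f := fun t : R => (t, x))); last exact: (c1_contt phiC1).
  by apply: continuous_pair => y; [exact: cvg_id|exact: cvg_cst].
- by move=> t; exact: (c1_dert phiC1).
- move=> t Tt; have Tt' : T < `|t| := lt_le_trans Tt (ler_norm t).
  by rewrite (c1_supp phiC1) ?(c1_suppt phiC1)//; left.
Qed.

Let dx_half_line_open t a : \int[mu]_x ((a < x)%R%:R * phix (t, x)) = - phi (t, a).
Proof.
rewrite Rintegral_half_line_open; first exact: dx_half_line.
exact: (box_bounded_sectionl t bphix).
Qed.

Let dt_half_line_open x a : \int[mu]_t ((a < t)%R%:R * phit (t, x)) = - phi (a, x).
Proof.
rewrite Rintegral_half_line_open; first exact: dt_half_line.
exact: (box_bounded_sectionr x bphit).
Qed.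

Hypothesis phi_x0 : forall t, 0 <= t -> phi (t, 0) = 0.

(** For fixed t the inner integral is phi (t, c t) - phi (t, 0), and phi
    vanishes on x = 0. *)
Lemma sector_integral_dx c : 0 <= c ->
  \int[mu2]_z ((sector c z)%:R * phix z) = ray_integral c.
Proof.
move=> c0; rewrite Rintegral_tx; last first.
  by apply: box_bounded_indicator => //; exact: measurable_sector.
apply: eq_Rintegral => t _; rewrite /sector/=.
have [t0|t0] := ltP 0 t; last first.
  by under eq_Rintegral do rewrite mul0r; rewrite mul0r Rintegral_cst// mul0r.
have ct0 : 0 <= c * t by rewrite mulr_ge0// ltW.
rewrite mul1r [LHS](_ : _ = \int[mu]_x ((0 < x)%R%:R * phix (t, x) - (c * t < x)%R%:R * phix (t, x))).
  rewrite RintegralB//; [|exact: box_bounded1_integrable (half_line_box _ (box_bounded_sectionl t bphix))..].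
  by rewrite !dx_half_line_open phi_x0 ?(ltW t0)// oppr0 opprK add0r.
apply: eq_Rintegral => x _ /=; rewrite -mulrBl; congr (_ * _).
have [x0|x0] := ltP 0 x => /=.
  by case: leP; rewrite ?subr0 ?subrr.
by rewrite [c * t < x]ltNge (le_trans x0 ct0) subrr.
Qed.

(** For fixed x the sector is the half-line t >= x / c, which contributes
    - phi (x / c, x); the substitution x = c t produces the factor c. *)
Lemma sector_integral_dt c : 0 <= c ->
  \int[mu2]_z ((sector c z)%:R * phit z) = - (c * ray_integral c).
Proof.
rewrite le_eqVlt => /predU1P[<-|c0].
  rewrite mul0r oppr0; under eq_Rintegral => z _.
    rewrite /sector mul0r (_ : 0 < z.2 <= 0 = false) ?andbF ?mul0r; last by case: ltgtP.
    over.
  by rewrite Rintegral_cst// mul0r.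
rewrite Rintegral_xt; last first.
  by apply: box_bounded_indicator => //; exact: measurable_sector.
rewrite -(@Rintegral_scale _ (fun t => phi (t, c * t)) T)//; last first.
  by move=> t Tt; rewrite (c1_supp phiC1)//; left; exact: lt_le_trans (ler_norm _).
rewrite -mulN1r -RintegralZl//; last first.
  apply: box_bounded1_integrable; apply: half_line_box; split.
  - have mray := continuous_measurable_fun (@continuous_ray c).
    have mdiv : measurable_fun [set: R] (fun x : R => x / c) by exact: mulrr_measurable.
    exact: (measurableT_comp mray mdiv).
  - by have [_ [M HM] _] := bphi; exists M => x.
  - exists T => x Tx; rewrite (c1_supp phiC1)//; right.
    by rewrite mulrC divfK ?gt_eqF.
apply: eq_Rintegral => x _ /=; rewrite /sector/=.
have [x0|x0] := ltP 0 x; last first.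
  under eq_Rintegral do rewrite /= andbF mul0r.
  by rewrite mul0r mulr0 Rintegral_cst// mul0r.
rewrite !mul1r mulN1r [c * (x / c)]mulrC divfK ?gt_eqF// -dt_half_line.
apply: eq_Rintegral => t _ /=; congr ((nat_of_bool _)%:R * _).
rewrite ler_pdivrMr// mulrC; case: ltP => //= t0.
by apply/esym/negbTE; rewrite -ltNge (le_lt_trans _ x0)// mulr_le0_ge0// ltW.
Qed.

Lemma quadrant_integral_dx :
  \int[mu2]_z ((quadrant z)%:R * phix z) = 0.
Proof.
rewrite Rintegral_tx; last first.
  by apply: box_bounded_indicator => //; exact: measurable_quadrant.
transitivity (\int[mu]_(t in setT) (0 : R)); last by rewrite Rintegral_cst// mul0r.
apply: eq_Rintegral => t _; rewrite /quadrant/=.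
have [t0|t0] := ltP 0 t; last first.
  by under eq_Rintegral do rewrite mul0r; rewrite Rintegral_cst// mul0r.
by rewrite /= dx_half_line_open phi_x0 ?oppr0// ltW.
Qed.

Lemma quadrant_integral_dt :
  \int[mu2]_z ((quadrant z)%:R * phit z) = - \int[mu]_x ((0 < x)%R%:R * phi (0, x)).
Proof.
rewrite Rintegral_xt; last first.
  by apply: box_bounded_indicator => //; exact: measurable_quadrant.
rewrite -mulN1r -RintegralZl//; last first.
  exact: box_bounded1_integrable (half_line_box _ (box_bounded_sectionl 0 bphi)).
apply: eq_Rintegral => x _; rewrite /quadrant/=.
have [x0|x0] := ltP 0 x; last first.
  under eq_Rintegral do rewrite andbF mul0r.
  by rewrite mul0r mulr0 Rintegral_cst// mul0r.
under eq_Rintegral do rewrite andbT.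
by rewrite dt_half_line_open mul1r mulN1r.
Qed.

(** The section at time t of the region between the rays of speeds c and d has
    length (d - c) t, hence at most (d - c) S. *)
Lemma sector_difference_area c d S : 0 <= c -> c <= d -> 0 <= S ->
  box_bounded (fun z : R * R => ((0 < z.1 <= S) && (c * z.1 < z.2 <= d * z.1))%:R : R) /\
  \int[mu2]_z ((0 < z.1 <= S) && (c * z.1 < z.2 <= d * z.1))%:R <= (d - c) * S ^+ 2.
Proof.
move=> c0 cd S0.
have bb : box_bounded (fun z : R * R => ((0 < z.1 <= S) && (c * z.1 < z.2 <= d * z.1))%:R : R).
  split.
  - apply: measurable_natr_bool; apply: measurable_and; apply: measurable_and.
    + exact: measurable_fun_ltr.
    + exact: measurable_fun_ler.
    + by apply: measurable_fun_ltr => //; exact: measurable_funM.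
    + by apply: measurable_fun_ler => //; exact: measurable_funM.
  - by exists 1 => z; case: (_ && _); rewrite ?normr1 ?normr0.
  - exists (S + d * S) => t x h /=; apply/eqP; rewrite pnatr_eq0 eqb0; apply/negP.
    move=> /andP[/andP[t0 tS] /andP[xc xd]].
    have d0 := le_trans c0 cd.
    have x0 : 0 < x by apply: le_lt_trans xc; rewrite mulr_ge0// ltW.
    have dt : d * t <= d * S by rewrite ler_wpM2l.
    have dS : 0 <= d * S by rewrite mulr_ge0.
    by case: h; rewrite gtr0_norm//; lra.
split=> //; rewrite Rintegral_tx//=.
rewrite [leLHS](_ : _ = \int[mu]_t ((0 < t <= S)%R%:R * ((d - c) * t))); last first.
  apply: eq_Rintegral => t _; have [/andP[t0 tS]|tS] := boolP (0 < t <= S); last first.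
    by rewrite mul0r/= Rintegral_cst// mul0r.
  by rewrite /= Rintegral_indicator_itv ?ler_wpM2r ?(ltW t0)// mulrBl mul1r.
have bt : box_bounded1 (fun t : R => (0 < t <= S)%R%:R * ((d - c) * t)).
  split.
  - apply: measurable_funM; last exact: measurable_funM.
    apply: measurable_natr_bool; apply: measurable_and.
    + exact: measurable_fun_ltr.
    + exact: measurable_fun_ler.
  - exists `|(d - c) * S| => t; have [/andP[t0 tS]|_] := boolP (0 < t <= S); last first.
      by rewrite mul0r normr0.
    have dc : 0 <= d - c by rewrite subr_ge0.
    rewrite mul1r ger0_norm ?mulr_ge0// ?(ltW t0)// ger0_norm ?mulr_ge0//.
    by rewrite ler_wpM2l.
  - exists S => t St; have [/andP[t0 tS]|_] := boolP (0 < t <= S); last by rewrite mul0r.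
    by move: St; rewrite gtr0_norm// ltNge tS.
apply: (@le_trans _ _ (\int[mu]_t ((0 < t <= S)%R%:R * ((d - c) * S)))).
  apply: le_Rintegral => //; [exact: box_bounded1_integrable bt| |].
    exact: box_bounded1_integrable (slab_box _ _).
  move=> t _; have [/andP[t0 tS]|_] := boolP (0 < t <= S); last by rewrite !mul0r.
  by rewrite !mul1r ler_wpM2l// subr_ge0.
by rewrite slab_integral// expr2 mulrCA.
Qed.

(** Summing the hypothesis over a uniform subdivision into n pieces telescopes
    both sides: H 0 - H Lam is at most C (Lam / n) (W Lam - W 0), for every n. *)
Lemma partition_monotone (H W : R -> R) (Lam C : R) : 0 <= Lam ->
  (forall c d, 0 <= c -> c <= d -> d <= Lam ->
    - (C * (d - c) * (W d - W c)) <= H d - H c) -> H 0 <= H Lam.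
Proof.
move=> L0 HW; rewrite leNgt; apply/negP => HL.
pose A := C * Lam * (W Lam - W 0).
have bound n : (H 0 - H Lam) * n.+1%:R <= A.
  pose x i := Lam * i%:R / n.+1%:R.
  have xS i : x i.+1 - x i = Lam / n.+1%:R.
    by rewrite /x -mulrBl -mulrBr -natrB// subSnn mulr1.
  have x0 : x 0%N = 0 by rewrite /x mulr0 mul0r.
  have xn : x n.+1 = Lam by rewrite /x mulfK.
  have step (i : nat) : (i < n.+1)%N ->
      - (C * (Lam / n.+1%:R) * (W (x i.+1) - W (x i))) <= H (x i.+1) - H (x i).
    move=> i_n; rewrite -(xS i); apply: HW.
    - by rewrite /x divr_ge0// mulr_ge0.
    - by rewrite -subr_ge0 xS divr_ge0.
    - by rewrite /x ler_pdivrMr// ler_wpM2l// ler_nat.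
  have : \sum_(0 <= i < n.+1) - (C * (Lam / n.+1%:R) * (W (x i.+1) - W (x i)))
      <= \sum_(0 <= i < n.+1) (H (x i.+1) - H (x i)).
    by rewrite big_nat [leRHS]big_nat; apply: ler_sum => i /andP[_]; exact: step.
  rewrite sumrN -big_distrr/= !telescope_sumr// x0 xn.
  rewrite lerNl opprB => /(ler_wpM2r (_ : 0 <= n.+1%:R :> R)) => /(_ (ler0n _ _)).
  move=> /le_trans; apply; rewrite /A.
  rewrite (_ : C * (Lam / n.+1%:R) * (W Lam - W 0) * n.+1%:R
    = C * Lam * (W Lam - W 0) * (n.+1%:R / n.+1%:R)); last by ring.
  by rewrite divff// mulr1.
have dH : 0 < H 0 - H Lam by rewrite subr_gt0.
have /(_ (A / (H 0 - H Lam))) [n] : forall y : R, exists n, y < n.+1%:R.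
  move=> y; exists (Num.bound `|y|); apply: (le_lt_trans (ler_norm y)).
  by apply: lt_trans (archi_boundP (normr_ge0 y)) _; rewrite ltr_nat.
by rewrite ltr_pdivrMr// mulrC ltNge bound.
Qed.

(** E and Q are an entropy and its flux along the rays of a self-similar
    function; W is a monotone function that controls their variation. *)
Variables (E Q W : R -> R) (Lam B : R).
Hypothesis (mE : measurable_fun setT E) (mQ : measurable_fun setT Q).
Hypothesis (EB : forall s, `|E s| <= B) (QB : forall s, `|Q s| <= B).
Hypothesis EW : forall s d, 0 <= s -> s <= d -> `|E s - E d| <= W d - W s.
Hypothesis QW : forall s d, 0 <= s -> s <= d -> `|Q s - Q d| <= W d - W s.
Hypothesis entropy : forall c d, 0 <= c -> c <= d ->
  Q d - Q c - c * (E d - E c) <= (d - c) * (W d - W c).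
Hypothesis (Lam0 : 0 <= Lam) (EQL : forall s, Lam < s -> E s = E Lam /\ Q s = Q Lam).
Hypothesis phi_ge0 : forall t x, 0 <= t -> 0 <= x -> 0 <= phi (t, x).

Let K (z : R * R) := E (z.2 / z.1) * phit z + Q (z.2 / z.1) * phix z.

Let mratio : measurable_fun setT (fun z : R * R => z.2 / z.1).
Proof.
apply: measurable_funM => //.
exact: (measurableT_comp measurable_inv measurable_fst).
Qed.

Lemma entropy_density_box : box_bounded K.
Proof.
apply: box_boundedD; apply: box_boundedM => //.
- exact: (measurableT_comp mE mratio).
- by exists B.
- exact: (measurableT_comp mQ mratio).
- by exists B.
Qed.

Let region_integral (p : R * R -> bool) e q : measurable_fun setT p ->
  \int[mu2]_z ((p z)%:R * (e * phit z + q * phix z)) =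
  e * \int[mu2]_z ((p z)%:R * phit z) + q * \int[mu2]_z ((p z)%:R * phix z).
Proof.
move=> mp; rewrite -!plane_integralZ; [|exact: box_bounded_indicator..].
rewrite -plane_integralD; [|by apply: box_boundedZ; exact: box_bounded_indicator..].
by apply: eq_Rintegral => z _; ring.
Qed.

Let Kcst e q : box_bounded (fun z => e * phit z + q * phix z).
Proof. by apply: box_boundedD; exact: box_boundedZ. Qed.

(** The boundary term makes H insensitive to the value of a constant state: if E
    and Q were constant, H would be zero. *)
Let H c := \int[mu2]_z ((sector c z)%:R * K z) - (Q c - c * E c) * ray_integral c.

(** Between the rays of speeds c and d, the density is compared with the one of
    the constant state (E d, Q d), whose integral is known exactly. What remains
    of H d - H c is - J c (Q d - Q c - c (E d - E c)), to which the discrete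
    entropy inequality applies because J c >= 0. *)
Lemma sector_functional_increment : exists C, forall c d, 0 <= c -> c <= d ->
  - (C * (d - c) * (W d - W c)) <= H d - H c.
Proof.
have [_ [Mt tM] _] := bphit; have [_ [Mx xM] _] := bphix.
have [_ [M0 M0M] _] := bphi.
pose S := `|T|.
exists (M0 * S + (Mt + Mx) * S ^+ 2) => c d c0 cd.
have d0 := le_trans c0 cd.
have Wcd : 0 <= W d - W c by apply: le_trans (EW c0 cd).
have dc : 0 <= d - c by rewrite subr_ge0.
have [bS areaS] := @sector_difference_area c d S c0 cd (normr_ge0 _).
set D := (fun z : R * R => _) in bS areaS.
pose Kd z := E d * phit z + Q d * phix z.
have bK := entropy_density_box; have bKd : box_bounded Kd by exact: Kcst.
have J0 : 0 <= ray_integral c.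
  apply: Rintegral_ge0 => t _; have [t0|_] := ltP 0 t; rewrite ?mul0r// mul1r.
  by rewrite phi_ge0 ?mulr_ge0// ltW.
have JM : ray_integral c <= M0 * S.
  apply: (@le_trans _ _ (\int[mu]_t ((0 < t <= S)%R%:R * M0))).
    apply: le_Rintegral => //; [exact: box_bounded1_integrable (ray_box c)| |].
      exact: box_bounded1_integrable (slab_box _ _).
    move=> t _ /=; have [t0|_] := ltP 0 t; rewrite ?mul0r//= mul1r.
    have [tS|St] := leP t S; first by rewrite mul1r (le_trans (ler_norm _)).
    rewrite (c1_supp phiC1) ?mul0r//; left.
    by rewrite (le_lt_trans (ler_norm T))// (lt_le_trans St)// ler_norm.
  by rewrite slab_integral ?normr_ge0// mulrC.
have diff (g : R * R -> R) : box_bounded g ->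
    \int[mu2]_z ((sector d z)%:R * g z) - \int[mu2]_z ((sector c z)%:R * g z) =
    \int[mu2]_z (((0 < z.1) && (c * z.1 < z.2 <= d * z.1))%:R * g z).
  move=> bg; rewrite -RintegralB//; [|by apply: box_bounded_integrable; apply: box_bounded_indicator => //; exact: measurable_sector..].
  apply: eq_Rintegral => -[t x] _ /=; rewrite -mulrBl; congr (_ * _).
  rewrite /sector/=; have [t0|_] := ltP 0 t; last by rewrite subrr.
  have ct0 : 0 <= c * t by rewrite mulr_ge0// ltW.
  have cdt : c * t <= d * t by rewrite ler_wpM2r// ltW.
  rewrite /=; have [x0|x0] := ltP 0 x => /=; last first.
    by rewrite [c * t < x]ltNge (le_trans x0 ct0) /= subrr.
  by have [xc|cx] := leP x (c * t); rewrite ?subr0//= (le_trans xc cdt) subrr.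
have mDl : measurable_fun setT (fun z : R * R => (0 < z.1) && (c * z.1 < z.2 <= d * z.1)).
  apply: measurable_and; first exact: measurable_fun_ltr.
  apply: measurable_and.
  - by apply: measurable_fun_ltr => //; exact: measurable_funM.
  - by apply: measurable_fun_ler => //; exact: measurable_funM.
pose N := (Mt + Mx) * (W d - W c).
(* On the region c < x / t <= d, E (x / t) and Q (x / t) are within W d - W c of
   E d and Q d; the support of the derivatives confines the error to t <= S. *)
have lower : \int[mu2]_z (((0 < z.1) && (c * z.1 < z.2 <= d * z.1))%:R * Kd z)
    - N * ((d - c) * S ^+ 2) <=
    \int[mu2]_z (((0 < z.1) && (c * z.1 < z.2 <= d * z.1))%:R * K z).
  have MM0 : 0 <= Mt + Mx.
    by apply: addr_ge0; [exact: le_trans (tM (0, 0))|exact: le_trans (xM (0, 0))].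
  have N0 : 0 <= N by rewrite /N mulr_ge0.
  apply: (@le_trans _ _ (\int[mu2]_z (((0 < z.1) && (c * z.1 < z.2 <= d * z.1))%:R * Kd z)
     + \int[mu2]_z (- N * D z))).
    by rewrite plane_integralZ// mulNr lerD2l lerN2 ler_wpM2l.
  rewrite -plane_integralD; [|exact: box_bounded_indicator mDl bKd|exact: box_boundedZ].
  apply: le_plane_integral.
  - by apply: box_boundedD; [exact: box_bounded_indicator mDl bKd|exact: box_boundedZ].
  - exact: box_bounded_indicator mDl bK.
  move=> [t x]; rewrite /D/=.
  have [t0|_] := ltP 0 t; last by rewrite /= !mul0r mulr0 add0r.
  have [/andP[xc xd]|_] := boolP (c * t < x <= d * t); last first.
    by rewrite /= !mul0r andbF mulr0 add0r.
  rewrite /= andbT !mul1r; have [tS|St] := leP t S; last first.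
    have Tt : T < `|t|.
      by rewrite (le_lt_trans (ler_norm T))// (lt_le_trans St)// ler_norm.
    rewrite /K /Kd (c1_suppt phiC1) ?(c1_suppx phiC1); [|by left..].
    by rewrite !mulr0 !addr0.
  have cx : c <= x / t by rewrite ler_pdivlMr// ltW.
  have xd' : x / t <= d by rewrite ler_pdivrMr.
  have xt0 := le_trans c0 cx.
  have Wx : W d - W (x / t) <= W d - W c.
    by rewrite lerD2l lerN2 -subr_ge0; apply: le_trans (EW c0 cx).
  have eE := le_trans (EW xt0 xd') Wx; have eQ := le_trans (QW xt0 xd') Wx.
  rewrite /K /Kd/= mulr1 lerBlDr -lerBlDl.
  apply: le_trans (ler_norm _) _.
  rewrite [X in `|X|](_ : _ = - ((E (x / t) - E d) * phit (t, x) + (Q (x / t) - Q d) * phix (t, x))); last by ring.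
  rewrite normrN (le_trans (ler_normD _ _))// /N [leRHS]mulrDl !normrM [Mt * _]mulrC [Mx * _]mulrC.
  by rewrite lerD// ler_pM.
rewrite /H.
have eK := diff K bK; have eKd := diff Kd bKd.
have mSc := measurable_sector c; have mSd := measurable_sector d.
rewrite /Kd !region_integral// in eKd.
rewrite !sector_integral_dt// !sector_integral_dx// in eKd.
have ent := entropy c0 cd.
have h1 : ray_integral c * (Q d - Q c - c * (E d - E c))
   <= ray_integral c * ((d - c) * (W d - W c)) by rewrite ler_wpM2l.
have h2 : ray_integral c * ((d - c) * (W d - W c)) <= M0 * S * ((d - c) * (W d - W c)).
  by rewrite ler_wpM2r// mulr_ge0.
rewrite /Kd region_integral// in lower.
rewrite /N in lower.
lra.
Qed.

(** Above the ray of speed Lam the density is that of the constant state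
    (E Lam, Q Lam); integrating it over the quadrant minus the sector turns the
    left-hand side into H Lam, while H 0 = 0 since phi vanishes on x = 0. *)
Theorem quadrant_entropy_inequality :
  0 <= \int[mu2]_z ((quadrant z)%:R * K z)
       + E Lam * \int[mu]_x ((0 < x)%R%:R * phi (0, x)).
Proof.
have [C HC] := sector_functional_increment.
have HL : H 0 <= H Lam.
  by apply: (partition_monotone (W := W) (C := C) Lam0) => c d c0 cd _; exact: HC.
have H0 : H 0 = 0.
  rewrite /H [X in X - _](_ : _ = 0); last first.
    transitivity (\int[mu2]_(z in setT) (0 : R)); last by rewrite Rintegral_cst// mul0r.
    apply: eq_Rintegral => z _; rewrite /sector mul0r.
    by rewrite (_ : 0 < z.2 <= 0 = false) ?andbF ?mul0r//; case: ltgtP.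
  rewrite /ray_integral [X in _ * X](_ : _ = 0) ?mulr0 ?subr0//.
  transitivity (\int[mu]_(t in setT) (0 : R)); last by rewrite Rintegral_cst// mul0r.
  apply: eq_Rintegral => t _; rewrite mul0r; have [t0|_] := ltP 0 t.
    by rewrite phi_x0 ?mulr0// ltW.
  by rewrite mul0r.
pose KL z := E Lam * phit z + Q Lam * phix z.
have bK := entropy_density_box; have bKL : box_bounded KL by exact: Kcst.
have mS := measurable_sector Lam; have mQu := measurable_quadrant.
have quadrantE : \int[mu2]_z ((quadrant z)%:R * K z) =
    \int[mu2]_z ((sector Lam z)%:R * K z)
    + (\int[mu2]_z ((quadrant z)%:R * KL z) - \int[mu2]_z ((sector Lam z)%:R * KL z)).
  rewrite -RintegralB//; [|by apply: box_bounded_integrable; exact: box_bounded_indicator..].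
  rewrite -RintegralD//; first last.
  - rewrite [X in integrable _ _ X](_ : _ =
      (fun z => (((quadrant z)%:R * KL z)%:E - ((sector Lam z)%:R * KL z)%:E)%E))//.
    by apply: integrableB => //; apply: box_bounded_integrable; exact: box_bounded_indicator.
  - by apply: box_bounded_integrable; exact: box_bounded_indicator.
  apply: eq_Rintegral => -[t x] _; rewrite /quadrant /sector/=.
  have [t0|_] := ltP 0 t; last by rewrite !mul0r subrr addr0.
  have [x0|_] := ltP 0 x => /=; last by rewrite !mul0r subrr addr0.
  have [xL|Lx] := leP x (Lam * t); first by rewrite subrr addr0.
  have [EL QL] : E (x / t) = E Lam /\ Q (x / t) = Q Lam.
    by apply: EQL; rewrite ltr_pdivlMr.
  by rewrite /K /KL/= EL QL !mul0r add0r subr0.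
rewrite quadrantE /KL !region_integral// quadrant_integral_dt quadrant_integral_dx.
rewrite sector_integral_dt// sector_integral_dx//.
rewrite H0 /H in HL.
lra.
Qed.

End EntropyInequality.

(** * Test functions, reflection and the Kruzhkov inequality on a half-line *)

Section TestFunctionData.
Context {R : realType}.

(** A partial derivative vanishes where xi vanishes on a neighbourhood, which is
    why the support condition is stated with strict inequalities. *)
Lemma Ccinfty2_C1_box (xi : R * R -> R) : Ccinfty2 xi ->
  exists T, C1_box xi (partial_t xi) (partial_x xi) T.
Proof.
case=> sxi cxi.
have [T supp] : exists T : R, forall t x, T < `|t| \/ T < `|x| -> xi (t, x) = 0.
  have [M [_ MM]] := compact_bounded cxi.
  exists (`|M| + 1) => t x h; apply/eqP; apply/negPn/negP => xi0.
  have : `|(t, x)| <= `|M| + 1.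
    apply: MM; first by rewrite (le_lt_trans (ler_norm _)) ?ltrDl.
    exact: subset_closure.
  by rewrite prod_normE ge_max /= => /andP[]; rewrite !leNgt; case: h => ->.
have [cx dx] : continuous xi /\ (forall t x, derivable (fun s => xi (s, x)) t 1 /\
    derivable (fun y => xi (t, y)) x 1) := sxi [::].
have [cxt _] : continuous (partial_t xi) /\ _ := sxi [:: true].
have [cxx _] : continuous (partial_x xi) /\ _ := sxi [:: false].
have zero_der (h : R -> R) (y : R) : (\forall z \near y, h z = 0) -> h^`()%classic y = 0.
  by move=> h0; rewrite derive1E (near_eq_derive (g := cst 0) _ h0) derive_cst.
have near_far (y : R) : T < `|y| -> \forall z \near y, T < `|z|.
  move=> Ty; have cn : {for y, continuous (fun z : R => `|z|)} by exact: norm_continuous.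
  exact: (cn _ (open_nbhs_nbhs (conj (@open_gt R T) Ty))).
exists T; split=> //.
- by move=> t x; rewrite /partial_t/= derive1E; apply: derivableP; exact: (dx t x).1.
- by move=> t x; rewrite /partial_x/= derive1E; apply: derivableP; exact: (dx t x).2.
- move=> t x h; rewrite /partial_t/=; apply: zero_der; case: h => [Tt|Tx].
    by apply: (@filterS _ (nbhs t) _ _ _ _ (near_far _ Tt)) => z Tz; apply: supp; left.
  exact: (@filterE _ (nbhs t) _ _ (fun z => supp z x (or_intror Tx))).
- move=> t x h; rewrite /partial_x/=; apply: zero_der; case: h => [Tt|Tx].
    exact: (@filterE _ (nbhs x) _ _ (fun z => supp t z (or_introl Tt))).
  by apply: (@filterS _ (nbhs x) _ _ _ _ (near_far _ Tx)) => z Tz; apply: supp; right.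
Qed.

Lemma C1_box_reflect (phi phit phix : R * R -> R) T : C1_box phi phit phix T ->
  C1_box (fun z => phi (z.1, - z.2)) (fun z => phit (z.1, - z.2))
    (fun z => - phix (z.1, - z.2)) T.
Proof.
move=> [c ct cx dt dx s st sx].
have cr : continuous (fun z : R * R => (z.1, - z.2)).
  move=> z.
  apply: (@cvg_pair _ _ _ (nbhs z) (nbhs z.1) (nbhs (- z.2)) _ _ _ fst (fun z => - z.2)).
    exact: cvg_fst.
  by apply: cvgN; exact: cvg_snd.
split.
- by move=> z; apply: (continuous_comp (cr z)); exact: c.
- by move=> z; apply: (continuous_comp (cr z)); exact: ct.
- by move=> z; apply: cvgN; apply: (continuous_comp (cr z)); exact: cx.
- by move=> t x /=; exact: dt.
- move=> t x /=.
  have d1 : is_derive x 1 (-%R : R -> R) (-1) by apply: is_deriveN.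
  have := @is_derive1_comp _ (fun y => phi (t, y)) (-%R) x _ _ (dx t (- x)) d1.
  by rewrite mulrN1.
- by move=> t x h; rewrite /= s// normrN.
- by move=> t x h; rewrite /= st// normrN.
- by move=> t x h; rewrite /= sx ?oppr0// normrN.
Qed.
End TestFunctionData.

Section Reflection.
Context {R : realType}.
Local Notation mu := (@lebesgue_measure R).

Lemma ge0_integral_reflect (A : set R) (f : R -> \bar R) : measurable A ->
  measurable_fun A f -> (forall x, A x -> (0 <= f x)%E) ->
  (\int[mu]_(x in A) f x = \int[mu]_(x in -%R @^-1` A) f (- x)%R)%E.
Proof.
move=> mA mf f0.
have mN : measurable_fun setT (-%R : measurableTypeR R -> measurableTypeR R).
  exact: oppr_measurable.
rewrite -[RHS](@ge0_integral_pushforward _ _ _ _ R (-%R : measurableTypeR R -> measurableTypeR R)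
  mN mu A f mA mf); last by move=> x /set_mem; exact: f0.
by apply: eq_measure_integral => B mB _; exact/esym/lebesgue_measureN.
Qed.

Lemma integral_reflect (A : set R) (f : R -> \bar R) : measurable A ->
  measurable_fun A f ->
  (\int[mu]_(x in A) f x = \int[mu]_(x in -%R @^-1` A) f (- x)%R)%E.
Proof.
move=> mA mf; rewrite integralE [RHS]integralE.
have fp : (\int[mu]_(x in A) f^\+ x = \int[mu]_(x in -%R @^-1` A) f^\+ (- x)%R)%E.
  by apply: ge0_integral_reflect => //; exact: measurable_funepos.
have fn : (\int[mu]_(x in A) f^\- x = \int[mu]_(x in -%R @^-1` A) f^\- (- x)%R)%E.
  by apply: ge0_integral_reflect => //; exact: measurable_funeneg.
rewrite fp fn; congr (_ - _)%E; apply: eq_integral => x _.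
  by rewrite (funepos_comp f -%R).
by rewrite (funeneg_comp f -%R).
Qed.
End Reflection.

Section HalfLine.
Context {R : realType}.
Local Notation mu := (@lebesgue_measure R).
Local Notation mu2 := (mu \x mu)%E.

(** The line t = 0 is negligible; leaving it out keeps the quotient x / t away
    from the conventional value of division by zero. *)
Lemma iterated_quadrant_integral (g : R * R -> R) : box_bounded g ->
  (\int[mu]_(t in `[0%R, +oo[) \int[mu]_(x in `]0%R, +oo[) (g (t, x))%:E)%E
  = (\int[mu2]_z ((quadrant z)%:R * g z))%:E.
Proof.
move=> bg; have bq := box_bounded_indicator measurable_quadrant bg.
have mp : measurable_fun setT (fun z : R * R => 0 < z.2) by exact: measurable_fun_ltr.
have bp := box_bounded_indicator mp bg.
have inner t : (\int[mu]_(x in `]0%R, +oo[) (g (t, x))%:E)%E =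
    (\int[mu]_x ((0 < x)%R%:R * g (t, x))%:E)%E.
  rewrite integral_mkcond; apply: eq_integral => x _.
  by rewrite patchE mem_setE in_itv/= andbT; case: ifPn => _; rewrite ?mul1r ?mul0r.
rewrite -iterated_integral// -integral_itv_obnd_cbnd; last first.
  apply: measurable_funTS; under [X in measurable_fun _ X]eq_fun do rewrite inner.
  exact: (measurable_fubini_F (box_bounded_integrable bp)).
rewrite integral_mkcond; apply: eq_integral => t _.
rewrite patchE mem_setE in_itv/= andbT; case: ifPn => t0; rewrite /quadrant/= ?t0.
  exact: inner.
by under eq_integral do rewrite (negbTE t0) mul0r; rewrite integral0.
Qed.

Lemma half_line_integral (h : R -> R) : box_bounded1 h ->
  (\int[mu]_(x in `]0%R, +oo[) (h x)%:E)%E = (\int[mu]_x ((0 < x)%R%:R * h x))%:E.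
Proof.
move=> bh; rewrite -(Rintegral_EFin (half_line_box 0 bh)).
rewrite integral_mkcond; apply: eq_integral => x _.
by rewrite patchE mem_setE in_itv/= andbT; case: ifPn => _; rewrite ?mul1r ?mul0r.
Qed.

End HalfLine.

Section RoadEntropy.
Context {R : realType}.
Local Notation mu := (@lebesgue_measure R).

Variables (rmax K : R) (F : R -> R) (a b : R).
Hypothesis (K0 : 0 < K) (lF : lipschitz_between rmax K F).
Hypothesis (ar : 0 <= a <= rmax) (br : 0 <= b <= rmax).

Let w := self_similar_state F a b.
Let wP z : riemann_state (fun r => F r - z * r) a b (w z).
Proof. exact: self_similar_stateP K0 lF ar br. Qed.

Lemma self_similar_state_range z : 0 <= w z <= rmax.
Proof.
have [+ _ _] := wP z; have /andP[? ?] := ar; have /andP[? ?] := br.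
by rewrite ge_min le_max => /andP[] /orP[] ? /orP[] ?; lra.
Qed.

Lemma self_similar_state_far z : K < z -> w z = b.
Proof. by move=> Kz; exact: riemann_state_far lF ar br Kz (wP z). Qed.

Lemma self_similar_state_monotone :
  {homo w : x y / x <= y} \/ {homo w : x y / x <= y >-> y <= x}.
Proof.
have [ab|ba] := leP a b; [left|right] => x y; rewrite le_eqVlt => /predU1P[->//|xy].
  exact: riemann_state_le ab xy (wP x) (wP y).
exact: riemann_state_ge (ltW ba) xy (wP x) (wP y).
Qed.

Lemma measurable_self_similar_state : measurable_fun setT w.
Proof.
have [wm|wm] := self_similar_state_monotone.
- by apply: nondecreasing_measurable => // x y _ _; exact: wm.
- by apply: nonincreasing_measurable => // x y _ _; exact: wm.
Qed.

Variable k : R.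
Hypothesis kr : 0 <= k <= rmax.

Let E s := `|w s - k|.
Let Q s := kruzhkov F (w s) k.

(** The factor 1 + K makes W control both the entropy, which is 1-Lipschitz in
    the state, and the entropy flux, which is K-Lipschitz. *)
Let variation : exists2 W : R -> R, {homo W : x y / x <= y} &
  forall s d, s <= d -> W d - W s = (1 + K) * `|w d - w s|.
Proof.
have K1 : 0 <= 1 + K by rewrite addr_ge0// ltW.
have [wm|wm] := self_similar_state_monotone.
- exists (fun s => (1 + K) * w s); first by move=> x y xy; rewrite ler_wpM2l// wm.
  by move=> s d sd; rewrite ger0_norm ?subr_ge0 ?wm// mulrBr.
- exists (fun s => - ((1 + K) * w s)).
    by move=> x y xy; rewrite lerN2 ler_wpM2l// wm.
  by move=> s d sd; rewrite ler0_norm ?subr_le0 ?wm//; ring.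
Qed.

Let Q_lipschitz s d : `|Q s - Q d| <= K * `|w s - w d|.
Proof.
by apply: (kruzhkov_lipschitz lF) => //; exact: self_similar_state_range.
Qed.

(** F is controlled on [0, rmax] only, so measurability is not inherited from F;
    but the entropy flux has bounded variation, being dominated by W, and Q + W
    and W are monotone. *)
Lemma measurable_kruzhkov_state : measurable_fun setT (fun s => kruzhkov F (w s) k).
Proof.
have [W Wm WE] := variation.
have QW : {homo (fun s => Q s + W s) : x y / x <= y}.
  move=> x y xy; have := Q_lipschitz x y; have := WE _ _ xy.
  rewrite (distrC (w y)) => h /ler_normlP[_ h2].
  have := normr_ge0 (w x - w y); lra.
rewrite (_ : (fun _ => _) = (fun s => (Q s + W s) - W s)); last by apply/funext => s; rewrite addrK.
apply: measurable_funB.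
- by apply: nondecreasing_measurable => // x y _ _; exact: QW.
- by apply: nondecreasing_measurable => // x y _ _; exact: Wm.
Qed.

Lemma half_plane_kruzhkov (phi phit phix : R * R -> R) T :
  C1_box phi phit phix T -> (forall t, 0 <= t -> phi (t, 0) = 0) ->
  (forall t x, 0 <= t -> 0 < x -> 0 <= phi (t, x)) ->
  (0 <= \int[mu]_(t in `[0%R, +oo[) \int[mu]_(x in `]0%R, +oo[)
          (`|w (x / t) - k| * phit (t, x)
           + kruzhkov F (w (x / t)) k * phix (t, x))%:E
        + \int[mu]_(x in `]0%R, +oo[) (`|b - k| * phi (0%R, x))%:E)%E.
Proof.
move=> c1 phi0 phip.
have [W Wm WE] := variation.
have mE : measurable_fun setT E.
  apply: measurableT_comp => //; apply: measurable_funB => //.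
  exact: measurable_self_similar_state.
have rmax0 : 0 <= rmax by have /andP[? ?] := ar; lra.
have EB s : `|E s| <= (1 + K) * rmax.
  rewrite /E normr_id (@le_trans _ _ rmax)//; last first.
    by rewrite ler_peMl// lerDl ltW.
  have /andP[? ?] := self_similar_state_range s; have /andP[? ?] := kr.
  by apply/ler_normlP; split; lra.
have Q0 s : `|Q s| <= K * `|w s - k|.
  rewrite /Q /kruzhkov normrM.
  apply: (@le_trans _ _ `|F (w s) - F k|); last by apply: lF => //; exact: self_similar_state_range.
  by rewrite -[leRHS]mul1r ler_wpM2r// normr_sg; case: (_ != _).
have QB s : `|Q s| <= (1 + K) * rmax.
  apply: (le_trans (Q0 s)); have := EB s; rewrite /E normr_id => h.
  have wr : `|w s - k| <= rmax.
    have /andP[? ?] := self_similar_state_range s; have /andP[? ?] := kr.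
    by apply/ler_normlP; split; lra.
  by rewrite ler_pM// ?(ltW K0)// lerDr.
have EW s d : 0 <= s -> s <= d -> `|E s - E d| <= W d - W s.
  move=> _ sd; rewrite WE// /E (le_trans (ler_dist_dist _ _))//.
  rewrite opprB addrA addrNK distrC ler_peMl// lerDl ltW//.
have QW s d : 0 <= s -> s <= d -> `|Q s - Q d| <= W d - W s.
  move=> _ sd; rewrite WE// (le_trans (Q_lipschitz s d))// distrC ler_wpM2r// lerDr//.
have ent c d : 0 <= c -> c <= d ->
    Q d - Q c - c * (E d - E c) <= (d - c) * (W d - W c).
  move=> _; rewrite le_eqVlt => /predU1P[->|cd]; first by rewrite !subrr mulr0 subr0 mulr0.
  have := entropy_increment k cd (wP c) (wP d) => /le_trans; apply.
  by rewrite WE ?(ltW cd)// ler_wpM2l ?subr_ge0 ?(ltW cd)// ler_peMl// lerDl ltW.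
have L0 : 0 <= K + 1 by rewrite addr_ge0// ltW.
have far s : K + 1 < s -> E s = E (K + 1) /\ Q s = Q (K + 1).
  move=> Ks; rewrite /E /Q !self_similar_state_far ?ltrDl//.
  by apply: lt_trans Ks; rewrite ltrDl.
have phig t x : 0 <= t -> 0 <= x -> 0 <= phi (t, x).
  move=> t0; rewrite le_eqVlt => /predU1P[<-|]; last exact: phip.
  by rewrite phi0.
have main := quadrant_entropy_inequality c1 phi0 mE measurable_kruzhkov_state EB QB EW QW ent L0 far phig.
have bphi := continuous_box_bounded (c1_cont c1) (c1_supp c1).
rewrite (@iterated_quadrant_integral _
  (fun z => E (z.2 / z.1) * phit z + Q (z.2 / z.1) * phix z)); last first.
  exact: (entropy_density_box c1 mE measurable_kruzhkov_state EB QB).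
rewrite half_line_integral; last first.
  exact: (box_bounded_sectionl 0 (box_boundedZ `|b - k| bphi)).
rewrite -EFinD lee_fin; apply: le_trans main _.
rewrite /E self_similar_state_far ?ltrDl// lerD2l -RintegralZl//; last first.
  exact: box_bounded1_integrable (half_line_box _ (box_bounded_sectionl 0 bphi)).
by under [leRHS]eq_Rintegral do rewrite mulrCA.
Qed.

End RoadEntropy.

(** * The Kruzhkov inequality on both kinds of roads *)

Section RoadKruzhkov.
Context {R : realType}.
Local Notation mu := (@lebesgue_measure R).

Variables (rmax K : R) (f : R -> R) (a b k : R).
Hypothesis (K0 : 0 < K) (lf : lipschitz_between rmax K f).
Hypothesis (ar : 0 <= a <= rmax) (br : 0 <= b <= rmax) (kr : 0 <= k <= rmax).
Variable xi : R * R -> R.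
Hypothesis (cxi : Ccinfty2 xi) (xi0 : forall t, 0 <= t -> xi (t, 0) = 0).

Lemma outgoing_kruzhkov (w := self_similar_state f a b) :
  (forall t x, 0 <= t -> 0 < x -> 0 <= xi (t, x)) ->
  (0 <= \int[mu]_(t in `[0%R, +oo[) \int[mu]_(x in `]0%R, +oo[)
          (`|w (`|x| / t) - k| * partial_t xi (t, x)
           + kruzhkov f (w (`|x| / t)) k * partial_x xi (t, x))%:E
        + \int[mu]_(x in `]0%R, +oo[) (`|b - k| * xi (0%R, x))%:E)%E.
Proof.
move=> xip; have [T c1] := Ccinfty2_C1_box cxi.
have main := half_plane_kruzhkov K0 lf ar br kr c1 xi0 xip.
have absE t : (\int[mu]_(x in `]0%R, +oo[)
          (`|w (`|x| / t) - k| * partial_t xi (t, x)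
           + kruzhkov f (w (`|x| / t)) k * partial_x xi (t, x))%:E =
    \int[mu]_(x in `]0%R, +oo[)
          (`|w (x / t) - k| * partial_t xi (t, x)
           + kruzhkov f (w (x / t)) k * partial_x xi (t, x))%:E)%E.
  by apply: eq_integral => x; rewrite inE/= in_itv/= andbT => x0; rewrite (gtr0_norm x0).
under eq_integral do rewrite absE.
exact: main.
Qed.

Let preimageN : (-%R : R -> R) @^-1` `]-oo, 0[%classic = `]0, +oo[%classic.
Proof. by apply/seteqP; split=> x /=; rewrite !in_itv/= andbT oppr_lt0. Qed.

(** The flux - f and the reflected test function turn this into the inequality
    on x > 0: the sign of the flux compensates that of the x-derivative. *)
Lemma incoming_kruzhkov (w := self_similar_state (fun r => - f r) a b) :
  (forall t x, 0 <= t -> x < 0 -> 0 <= xi (t, x)) ->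
  (0 <= \int[mu]_(t in `[0%R, +oo[) \int[mu]_(x in `]-oo, 0%R[)
          (`|w (`|x| / t) - k| * partial_t xi (t, x)
           + kruzhkov f (w (`|x| / t)) k * partial_x xi (t, x))%:E
        + \int[mu]_(x in `]-oo, 0%R[) (`|b - k| * xi (0%R, x))%:E)%E.
Proof.
move=> xip; have [T c1] := Ccinfty2_C1_box cxi.
have lF := lipschitz_between_opp lf.
have mw := measurable_self_similar_state K0 lF ar br.
have mQ : measurable_fun setT (fun s => kruzhkov f (w s) k).
  rewrite (_ : (fun _ => _) = (fun s => - kruzhkov (fun r => - f r) (w s) k)).
    by apply: measurable_funN; exact: (measurable_kruzhkov_state K0 lF ar br kr).
  by apply/funext => s; rewrite /kruzhkov -opprD mulrN opprK.
have mabs t : measurable_fun setT (fun x : R => `|x| / t).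
  by apply: measurable_funM => //; exact: measurableT_comp.
have mN : measurable_fun setT (-%R : R -> R) by exact: oppr_measurable.
have reflectE t : (\int[mu]_(x in `]-oo, 0%R[)
          (`|w (`|x| / t) - k| * partial_t xi (t, x)
           + kruzhkov f (w (`|x| / t)) k * partial_x xi (t, x))%:E =
    \int[mu]_(x in `]0%R, +oo[)
          (`|w (x / t) - k| * partial_t xi (t, - x)
           + kruzhkov (fun r => - f r) (w (x / t)) k * - partial_x xi (t, - x))%:E)%E.
  rewrite integral_reflect// ?preimageN.
    apply: eq_integral => x; rewrite inE/= in_itv/= andbT => x0.
    by rewrite normrN (gtr0_norm x0) /kruzhkov; congr (_%:E); ring.
  apply: measurable_funTS; apply/measurable_EFinP; apply: measurable_funD.
    apply: measurable_funM.
      apply: measurableT_comp => //; apply: measurable_funB => //.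
      exact: (measurableT_comp mw (mabs t)).
    apply: (measurableT_comp (f := partial_t xi) (g := pair t)).
      exact: continuous_measurable_plane (c1_contt c1).
    exact: pair1_measurable.
  apply: measurable_funM; first exact: (measurableT_comp mQ (mabs t)).
  apply: (measurableT_comp (f := partial_x xi) (g := pair t)).
    exact: continuous_measurable_plane (c1_contx c1).
  exact: pair1_measurable.
have initE : (\int[mu]_(x in `]-oo, 0%R[) (`|b - k| * xi (0%R, x))%:E
    = \int[mu]_(x in `]0%R, +oo[) (`|b - k| * xi (0%R, - x)%R)%:E)%E.
  rewrite integral_reflect// ?preimageN//; apply: measurable_funTS.
  apply/measurable_EFinP; apply: measurable_funM => //.
  apply: (measurableT_comp (f := xi) (g := pair 0)).
    exact: continuous_measurable_plane (c1_cont c1).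
  exact: pair1_measurable.
rewrite initE; under eq_integral do rewrite reflectE.
apply: (half_plane_kruzhkov K0 lF ar br kr (C1_box_reflect c1)).
- by move=> t t0; rewrite /= oppr0 xi0.
- by move=> t x t0 x0; apply: xip => //; rewrite oppr_lt0.
Qed.
End RoadKruzhkov.

(** * The trace of a self-similar solution *)

Section RightLimit.
Context {R : realType}.

Lemma monotone_right_limit (w : R -> R) (M : R) : (forall z, `|w z| <= M) ->
  {homo w : x y / x <= y} \/ {homo w : x y / x <= y >-> y <= x} ->
  exists g, (forall x y, 0 < x -> x <= y -> `|w x - g| <= `|w y - g|) /\
    (forall e, 0 < e -> exists2 d, 0 < d & `|w d - g| < e).
Proof.
move=> wM; wlog wm : w wM / {homo w : x y / x <= y}.
  move=> incr [wm|wm]; first exact: incr (or_introl wm).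
  have NM z : `|- w z| <= M by rewrite normrN.
  have Nm : {homo (fun z => - w z) : x y / x <= y}.
    by move=> x y xy; rewrite lerN2 wm.
  have [g [g1 g2]] := incr _ NM Nm (or_introl Nm).
  have gN z : `|- w z - g| = `|w z - - g| by rewrite -normrN opprB !opprK addrC.
  exists (- g); split=> [x y x0 xy|e e0].
    by rewrite -!gN; exact: g1.
  by have [d d0 gd] := g2 e e0; exists d => //; rewrite -gN.
move=> _; pose A := [set w z | z in `]0, +oo[%classic].
have A0 : A !=set0 by exists (w 1), 1 => //=; rewrite in_itv/= ltr01.
have lA : has_lbound A.
  by exists (- M) => _ [z _ <-]; have := wM z; rewrite ler_norml => /andP[].
have gle z : 0 < z -> inf A <= w z.
  by move=> z0; apply: ge_inf => //; exists z => //=; rewrite in_itv/= z0.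
exists (inf A); split=> [x y x0 xy|e e0].
  rewrite !ger0_norm ?subr_ge0 ?gle ?(lt_le_trans x0)//.
  by rewrite lerD2r wm.
have [_ [d + <-] dlt] := inf_adherent e0 (conj A0 lA).
rewrite /= in_itv/= andbT => d0; exists d => //.
by rewrite ger0_norm ?subr_ge0 ?gle// ltrBlDl.
Qed.
End RightLimit.

Section RoadTrace.
Context {R : realType}.
Local Notation mu := (@lebesgue_measure R).
Local Notation mu2 := (mu \x mu)%E.
Variables (rmax K : R) (F : R -> R) (a b : R).
Hypothesis (K0 : 0 < K) (lF : lipschitz_between rmax K F).
Hypothesis (ar : 0 <= a <= rmax) (br : 0 <= b <= rmax).

Let w := self_similar_state F a b.
Let wr z : 0 <= w z <= rmax := self_similar_state_range K0 lF ar br z.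

(** Optimality passes to the limit z -> 0 because F is continuous and the tilt
    [z * s] is bounded by [z * rmax]. *)
Lemma self_similar_trace : exists g,
  [/\ 0 <= g <= rmax, riemann_state F a b g,
      forall x y, 0 < x -> x <= y -> `|w x - g| <= `|w y - g| &
      forall e, 0 < e -> exists2 d, 0 < d & `|w d - g| < e].
Proof.
have wM z : `|w z| <= rmax by have /andP[w0 w1] := wr z; rewrite ger0_norm.
have [g [g1 g2]] := monotone_right_limit wM (self_similar_state_monotone K0 lF ar br).
have small e : 0 < e -> exists z, [/\ 0 < z, z <= e & `|w z - g| <= e].
  move=> e0; have [d d0 gd] := g2 e e0; exists (Num.min d e); split.
  - by rewrite lt_min d0 e0.
  - by rewrite ge_min lexx orbT.
  - apply: le_trans (ltW gd); apply: g1; first by rewrite lt_min d0 e0.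
    by rewrite ge_min lexx.
have closed_range l r : (forall z, l <= w z <= r) -> l <= g <= r.
  move=> lr; apply/andP; split; apply/ler_addgt0Pl => e e0;
    have [z [_ _ /ler_normlP[? ?]]] := small e e0; have /andP[? ?] := lr z; lra.
have gr : 0 <= g <= rmax by apply: closed_range.
have wP z := self_similar_stateP z K0 lF ar br.
have rmax0 : 0 <= rmax by have /andP[? ?] := ar; lra.
have ineq e : 0 < e -> exists z, [/\ 0 < z, F g <= F (w z) + K * e,
    F (w z) <= F g + K * e & z * rmax <= e * rmax].
  move=> e0; have [z [z0 ze wz]] := small e e0; exists z.
  have Ke : K * `|w z - g| <= K * e by rewrite ler_pM2l.
  have /ler_normlP[? ?] := lF (wr z) gr.
  by split=> //; [lra|lra|rewrite ler_wpM2r].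
have KR : 0 < K + rmax by rewrite ltr_pwDl.
exists g; split=> //; split.
- apply: closed_range => z; by case: (wP z).
- move=> ab s sab; apply/ler_addgt0Pl => e e0.
  have [z [z0 h1 h2 h3]] := ineq _ (divr_gt0 e0 KR).
  have [+ + _] := wP z => + /(_ ab s sab); rewrite min_l// max_r// => wab h4.
  have : z * (w z - s) <= z * rmax.
    rewrite ler_wpM2l ?(ltW z0)//; have /andP[? ?] := wr z; have /andP[? ?] := sab.
    by have /andP[? ?] := ar; lra.
  have : K * (e / (K + rmax)) + e / (K + rmax) * rmax = e.
    by rewrite mulrC -mulrDr divfK// gt_eqF.
  by rewrite -/w in h4 *; lra.
- move=> ba s sab; apply/ler_addgt0Pl => e e0.
  have [z [z0 h1 h2 h3]] := ineq _ (divr_gt0 e0 KR).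
  have [+ _ +] := wP z => + /(_ ba s sab); rewrite min_r// max_l// => wab h4.
  have : z * (s - w z) <= z * rmax.
    rewrite ler_wpM2l ?(ltW z0)//; have /andP[? ?] := wr z; have /andP[? ?] := sab.
    by have /andP[? ?] := ar; lra.
  have : K * (e / (K + rmax)) + e / (K + rmax) * rmax = e.
    by rewrite mulrC -mulrDr divfK// gt_eqF.
  by rewrite -/w in h4 *; lra.
Qed.

Variables (g : R).
Hypothesis (gr : 0 <= g <= rmax)
  (wg : forall x y, 0 < x -> x <= y -> `|w x - g| <= `|w y - g|)
  (wg0 : forall e, 0 < e -> exists2 d, 0 < d & `|w d - g| < e).

Let mw : measurable_fun setT w := measurable_self_similar_state K0 lF ar br.

Variables (xi : R -> R) (T M : R).
Hypothesis (mxi : measurable_fun setT xi) (xiM : forall t, `|xi t| <= M)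
  (xiT : forall t, T < `|t| -> xi t = 0).

Let dens (k : R) (z : R * R) :=
  (0 < z.2 < k)%R%:R * (xi z.1 * `|w (z.2 / z.1) - g|).

Let wgr z : `|w z - g| <= rmax.
Proof.
have /andP[? ?] := wr z; have /andP[? ?] := gr.
by apply/ler_normlP; split; lra.
Qed.

Lemma trace_density_box k : box_bounded (dens k).
Proof.
have M0 : 0 <= M := le_trans (normr_ge0 _) (xiM 0).
have rmax0 : 0 <= rmax by have /andP[? ?] := ar; lra.
split.
- apply: measurable_funM.
    apply: measurable_natr_bool; apply: measurable_and; exact: measurable_fun_ltr.
  apply: measurable_funM; first exact: (measurableT_comp mxi measurable_fst).
  apply: measurableT_comp => //; apply: measurable_funB => //.
  apply: (measurableT_comp mw); apply: measurable_funM => //.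
  exact: (measurableT_comp measurable_inv measurable_fst).
- exists (M * rmax) => z; rewrite /dens normrM normrM normr_id.
  rewrite -[leRHS]mul1r ler_pM// ?mulr_ge0//; last by rewrite ler_pM.
  by case: (_ && _); rewrite ?normr1 ?normr0.
- exists (Num.max T k) => t x; rewrite !gt_max /dens/= => -[/andP[Tt _]|/andP[_ kx]].
    by rewrite xiT// mul0r mulr0.
  have [/andP[x0 xk]|_] := boolP (0 < x < k); last by rewrite mul0r.
  by move: kx; rewrite gtr0_norm// ltNge ltW.
Qed.

(** Times t <= d, where x / t is not small, contribute at most a multiple of d;
    for t > d, x / t < k / d and the distance of w to its right limit g is at
    most the one at k / d. *)
Lemma trace_density_bound d k : 0 < d -> 0 < k ->
  `|\int[mu2]_z ((quadrant z)%:R * dens k z)|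
  <= k * (M * (d * rmax + `|T| * `|w (k / d) - g|)).
Proof.
move=> d0 k0; have M0 : 0 <= M := le_trans (normr_ge0 _) (xiM 0).
have rmax0 : 0 <= rmax by have /andP[? ?] := ar; lra.
pose dom (z : R * R) : R := (0 < z.2 <= k)%R%:R *
  (M * ((0 < z.1 <= d)%R%:R * rmax + (0 < z.1 <= `|T|)%R%:R * `|w (k / d) - g|)).
have bq := box_bounded_indicator measurable_quadrant (trace_density_box k).
have bdom : box_bounded dom.
  split.
  - apply: measurable_funM.
      apply: measurable_natr_bool; apply: measurable_and.
      + exact: measurable_fun_ltr.
      + exact: measurable_fun_ler.
    apply: measurable_funM => //; apply: measurable_funD; apply: measurable_funM => //;
      apply: measurable_natr_bool; apply: measurable_and.
    + exact: measurable_fun_ltr.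
    + exact: measurable_fun_ler.
    + exact: measurable_fun_ltr.
    + exact: measurable_fun_ler.
  - exists (M * (rmax + `|w (k / d) - g|)) => z; rewrite /dom.
    set s := (_ * rmax + _).
    have s0 : 0 <= s by rewrite addr_ge0 ?mulr_ge0.
    have sM : s <= rmax + `|w (k / d) - g|.
      by apply: lerD; rewrite ler_piMl//; case: (_ && _).
    rewrite !normrM (ger0_norm M0) (ger0_norm s0).
    rewrite -[leRHS]mul1r ler_pM ?mulr_ge0//; last by rewrite ler_wpM2l.
    by case: (_ && _); rewrite ?normr1 ?normr0.
  - exists (d + `|T| + k) => t x tx; rewrite /dom/=.
    have T0 := normr_ge0 T.
    have [/andP[x0 xk]|_] := boolP (0 < x <= k); last by rewrite mul0r.
    have [/andP[t0 td]|_] := boolP (0 < t <= d).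
      by exfalso; case: tx; rewrite ?(gtr0_norm t0) ?(gtr0_norm x0) => ?; lra.
    have [/andP[t0 tT]|_] := boolP (0 < t <= `|T|).
      by exfalso; case: tx; rewrite ?(gtr0_norm t0) ?(gtr0_norm x0) => ?; lra.
    by rewrite !mul0r addr0 !mulr0.
have -> : k * (M * (d * rmax + `|T| * `|w (k / d) - g|)) = \int[mu2]_z dom z.
  rewrite Rintegral_xt// /dom/=.
  have inner x : \int[mu]_t ((0 < x <= k)%R%:R *
      (M * ((0 < t <= d)%R%:R * rmax + (0 < t <= `|T|)%R%:R * `|w (k / d) - g|)))
      = (0 < x <= k)%R%:R * (M * (d * rmax + `|T| * `|w (k / d) - g|)).
    have b1 := slab_box d rmax; have b2 := slab_box `|T| (`|w (k / d) - g|).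
    have i1 := box_bounded1_integrable b1; have i2 := box_bounded1_integrable b2.
    have i12 : mu.-integrable setT (EFin \o (fun t : R =>
        (0 < t <= d)%R%:R * rmax + (0 < t <= `|T|)%R%:R * `|w (k / d) - g|)).
      have := integrableD measurableT i1 i2.
      by apply: eq_integrable => // t _; rewrite /= EFinD.
    under eq_Rintegral do rewrite mulrA.
    rewrite (RintegralZl _ measurableT i12) (RintegralD measurableT i1 i2).
    by rewrite !slab_integral ?(ltW d0)// mulrA.
  by under eq_Rintegral do rewrite inner; rewrite slab_integral// ltW.
apply: (@le_trans _ _ (\int[mu2]_z `|(quadrant z)%:R * dens k z|)).
  by apply: le_normr_Rintegral => //; exact: box_bounded_integrable.
apply: le_Rintegral => //.
- by apply: integrable_norm; exact: box_bounded_integrable.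
- exact: box_bounded_integrable.
move=> -[t x] _; rewrite /dens /dom /quadrant/=.
have [t0|_] := ltP 0 t; last by rewrite mul0r normr0 !mul0r addr0 !mulr0.
have [x0|_] := ltP 0 x => /=; last by rewrite !mul0r normr0.
rewrite mul1r; have [xk|kx] := ltP x k; last by rewrite mul0r normr0 !mulr_ge0// addr_ge0 ?mulr_ge0.
rewrite (ltW xk) !mul1r normrM normr_id.
have [td|dt] := leP t d.
  rewrite mul1r ler_pM// (le_trans (wgr _))// lerDl mulr_ge0//.
have [tT|Tt] := leP t `|T|; last first.
  rewrite xiT ?normr0 ?mul0r//; last first.
    by rewrite (le_lt_trans (ler_norm T))// (lt_le_trans Tt)// ler_norm.
  by rewrite ?mul0r ?addr0 ?mulr0 ?lexx.
rewrite mul0r add0r mul1r ler_pM//; apply: wg; first by rewrite divr_gt0.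
by rewrite ler_pM// ?invr_ge0 ?(ltW x0) ?(ltW t0) ?(ltW xk)// lef_pV2 ?posrE// ltW.
Qed.

Lemma trace_limit :
  ((k^-1)%:E * \int[mu]_(t in `[0%R, +oo[) \int[mu]_(x in `]0%R, k[)
     (xi t * `|w (x / t) - g|)%:E)%E @[k --> 0^'+] --> 0%E.
Proof.
have M0 : 0 <= M := le_trans (normr_ge0 _) (xiM 0).
have rmax0 : 0 <= rmax by have /andP[? ?] := ar; lra.
pose A k := k^-1 * \int[mu2]_z ((quadrant z)%:R * dens k z).
have AE : {near 0^'+, (fun k => (A k)%:E) =1
    (fun k => (k^-1)%:E * \int[mu]_(t in `[0%R, +oo[) \int[mu]_(x in `]0%R, k[)
     (xi t * `|w (x / t) - g|)%:E)%E}.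
  near=> k; have k0 : 0 < k by near: k; exact: nbhs_right_gt.
  rewrite /A EFinM -iterated_quadrant_integral; last exact: trace_density_box.
  congr (_ * _)%E; apply: eq_integral => t _.
  rewrite [RHS]integral_mkcond [LHS]integral_mkcond; apply: eq_integral => x _.
  rewrite !patchE !mem_setE !in_itv/= andbT /dens/=.
  have [x0|_] := ltP 0 x => //=.
  by case: (x < k); rewrite ?mul1r ?mul0r.
apply: cvg_trans (near_eq_cvg AE) _.
apply: cvg_EFin; first by near=> k.
apply/cvgr0Pnorm_le => e e0.
(* d makes the contribution of small times less than e / 2; the added 1 only
   prevents a division by zero when M = 0. *)
pose d := e / 2 / (M * rmax + 1).
have Mr : 0 < M * rmax + 1 by rewrite ltr_wpDl// mulr_ge0.
have d0 : 0 < d by rewrite !divr_gt0.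
have MT : 0 < M * `|T| + 1 by rewrite ltr_wpDl// mulr_ge0.
have [y y0 yg] := wg0 (divr_gt0 (divr_gt0 e0 (ltr0n _ 2)) MT).
near=> k; have k0 : 0 < k by near: k; exact: nbhs_right_gt.
have kyd : k <= y * d by near: k; apply: nbhs_right_le; rewrite mulr_gt0.
have kd : `|w (k / d) - g| <= `|w y - g|.
  by apply: wg; rewrite ?divr_gt0// ler_pdivrMr.
have := trace_density_bound d0 k0.
rewrite /A/= normrM gtr0_norm ?invr_gt0// ler_pdivrMl// => /le_trans; apply.
rewrite ler_pM2l// mulrDr.
have h1 : M * (d * rmax) <= e / 2.
  rewrite /d [leLHS](_ : _ = e / 2 * (M * rmax / (M * rmax + 1))); last by ring.
  rewrite -[leRHS]mulr1 ler_wpM2l ?divr_ge0 ?(ltW e0)//.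
  by rewrite ler_pdivrMr// mul1r lerDl.
have h2 : M * (`|T| * `|w (k / d) - g|) <= e / 2.
  rewrite mulrA (@le_trans _ _ (M * `|T| * (e / 2 / (M * `|T| + 1))))//.
    by rewrite ler_wpM2l ?mulr_ge0// (le_trans kd)// ltW.
  rewrite [leLHS](_ : _ = e / 2 * (M * `|T| / (M * `|T| + 1))); last by ring.
  rewrite -[leRHS]mulr1 ler_wpM2l ?divr_ge0 ?(ltW e0)//.
  by rewrite ler_pdivrMr// mul1r lerDl.
by rewrite [leRHS](splitr e) lerD.
Unshelve. all: by end_near. Qed.

End RoadTrace.

(** * Two traces of the same function agree in the weak sense *)

Section TraceUniqueness.
Context {R : realType}.
Local Notation mu := (@lebesgue_measure R).
Local Notation mu2 := (mu \x mu)%E.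
Local Notation Rplus := (`[(0 : R), +oo[%classic : set R).

Lemma ge0_integral_rectangle (A B : set R) (f : R * R -> \bar R) :
  measurable A -> measurable B -> measurable_fun (A `*` B) f ->
  (forall z, (A `*` B) z -> (0 <= f z)%E) ->
  (\int[mu]_(t in A) \int[mu]_(x in B) f (t, x) = \int[mu2]_(z in A `*` B) f z)%E.
Proof.
move=> mA mB mf f0; have mAB : measurable (A `*` B) by exact: measurableX.
rewrite [RHS]integral_mkcond fubini_tonelli1//.
- rewrite integral_mkcond; apply: eq_integral => t _; rewrite /fubini_F patchE.
  case: ifPn => tA.
    rewrite [LHS]integral_mkcond; apply: eq_integral => x _; rewrite !patchE.
    by rewrite in_setX/= tA.
  by apply/esym; apply: integral0_eq => x _; rewrite patchE in_setX/= (negbTE tA).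
- apply/(measurable_restrictT _ _).1 => //.
- by apply: erestrict_ge0.
Qed.

(** The triangle inequality bounds k int xi |g1 - g2|, which is the integral of
    xi |g1 - g2| over the strip N k of width k, by the sum of the integrals that
    define the two traces; dividing by k and letting k -> 0 gives 0. *)
Lemma trace_weak_unique (D : set R) (N : R -> set R) (r : R * R -> R) (g1 g2 xi : R -> R) :
  measurable D -> (forall k, 0 < k -> [/\ measurable (N k), N k `<=` D & mu (N k) = k%:E]) ->
  measurable_fun (Rplus `*` D) r ->
  measurable_fun Rplus g1 -> measurable_fun Rplus g2 ->
  measurable_fun setT xi -> (forall t, 0 <= xi t) ->
  ((k^-1)%:E * \int[mu]_(t in Rplus) \int[mu]_(x in N k)
     (xi t * `|r (t, x) - g1 t|)%:E)%E @[k --> 0^'+] --> 0%E ->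
  ((k^-1)%:E * \int[mu]_(t in Rplus) \int[mu]_(x in N k)
     (xi t * `|r (t, x) - g2 t|)%:E)%E @[k --> 0^'+] --> 0%E ->
  (\int[mu]_(t in Rplus) (xi t * `|g1 t - g2 t|)%:E = 0)%E.
Proof.
move=> mD HN mr mg1 mg2 mxi xi0 c1 c2.
have mP : measurable Rplus by exact: measurable_itv.
have mdiff (k : R) (g : R -> R) : 0 < k -> measurable_fun Rplus g ->
    measurable_fun (Rplus `*` N k) (fun z => (xi z.1 * `|r z - g z.1|)%:E).
  move=> k0 mg; have [mN ND _] := HN k k0.
  have mPN : measurable (Rplus `*` N k) by exact: measurableX.
  apply/measurable_EFinP; apply: measurable_funM.
    by apply: measurable_funTS; exact: (measurableT_comp mxi measurable_fst).
  apply: measurableT_comp => //; apply: measurable_funB.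
    apply: measurable_funS mr => //; first exact: measurableX.
    by move=> [t x] [/= Pt Nx]; split=> //=; exact: ND.
  apply: (measurable_comp (F := Rplus)) => //.
  - by move=> _ [[t x] [/= Pt _] <-].
  - by apply: measurable_funTS; exact: measurable_fst.
have mg12 : measurable_fun Rplus (fun t => (xi t * `|g1 t - g2 t|)%:E).
  apply/measurable_EFinP; apply: measurable_funM; first exact: measurable_funTS.
  by apply: measurableT_comp => //; exact: measurable_funB.
have pos (a b : R) t : (0 <= (xi t * `|a - b|)%:E)%E by rewrite lee_fin mulr_ge0.
set I := (\int[mu]_(t in Rplus) (xi t * `|g1 t - g2 t|)%:E)%E.
have bound k : 0 < k -> (I <= (k^-1)%:E * \int[mu]_(t in Rplus) \int[mu]_(x in N k)
     (xi t * `|r (t, x) - g1 t|)%:E + (k^-1)%:E * \int[mu]_(t in Rplus) \int[mu]_(x in N k)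
     (xi t * `|r (t, x) - g2 t|)%:E)%E.
  move=> k0; have [mN ND muN] := HN k k0.
  have kI : (k%:E * I <= \int[mu]_(t in Rplus) \int[mu]_(x in N k)
     (xi t * `|r (t, x) - g1 t|)%:E + \int[mu]_(t in Rplus) \int[mu]_(x in N k)
     (xi t * `|r (t, x) - g2 t|)%:E)%E.
    rewrite (ge0_integral_rectangle (f := fun z => (xi z.1 * `|r z - g1 z.1|)%:E))//; last exact: mdiff.
    rewrite (ge0_integral_rectangle (f := fun z => (xi z.1 * `|r z - g2 z.1|)%:E))//; last exact: mdiff.
    have mPN : measurable (Rplus `*` N k) by exact: measurableX.
    rewrite -ge0_integralD//; [|exact: mdiff..].
    have -> : (k%:E * I = \int[mu]_(t in Rplus) \int[mu]_(x in N k)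
       (xi t * `|g1 t - g2 t|)%:E)%E.
      rewrite -ge0_integralZl//; last by rewrite lee_fin ltW.
      by apply: eq_integral => t _; rewrite integral_cst// [X in _ = (_ * X)%E]muN muleC.
    have m12 : measurable_fun (Rplus `*` N k) (fun z => (xi z.1 * `|g1 z.1 - g2 z.1|)%:E).
      apply: (measurable_comp (F := Rplus) (f := fun t => (xi t * `|g1 t - g2 t|)%:E)) => //.
      - by move=> _ [[t x] [/= Pt _] <-].
      - by apply: measurable_funTS; exact: measurable_fst.
    rewrite (ge0_integral_rectangle (f := fun z => (xi z.1 * `|g1 z.1 - g2 z.1|)%:E))//.
    apply: ge0_le_integral => //.
    - by apply: emeasurable_funD; exact: mdiff.
    - move=> z _; rewrite -EFinD lee_fin -mulrDr ler_wpM2l//.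
      by rewrite (distrC (r z) (g1 z.1)) (le_trans _ (ler_normD _ _))// addrA addrNK.
  rewrite -ge0_muleDr ?integral_ge0//; first last.
  - by move=> t _; apply: integral_ge0.
  - by move=> t _; apply: integral_ge0.
  have kn : k != 0 by rewrite gt_eqF.
  by rewrite -[leLHS]mul1e -(mulVf kn) EFinM -muleA lee_pmul2l// lte_fin invr_gt0.
have I0 : (0 <= I)%E by apply: integral_ge0.
apply/eqP; rewrite eq_le I0 andbT.
have right_filter : Filter (0 : R)^'+ by typeclasses eauto.
have fin0 : (0 : \bar R) \is a fin_num by [].
have := cvgeD (fin_num_adde_defl _ fin0) c1 c2.
rewrite adde0 => /(_ right_filter) c12.
rewrite -(cvg_lim _ c12)//; apply: lime_ge; first by apply/cvg_ex; exists 0%E.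
near=> k; apply: bound; near: k; exact: nbhs_right_gt.
Unshelve. all: by end_near. Qed.

End TraceUniqueness.

(** * A smooth bump function *)

Section Bump.
Context {R : realType}.
Implicit Types (P Q : {poly R}) (l : seq ({poly R} * {poly R})).

(** Functions P(1/x) exp(-1/x), extended by 0: the smallest family that contains
    exp(-1/x) and is closed under differentiation. *)
Definition flat_exp P (x : R) : R :=
  if 0 < x then P.[x^-1] * expR (- x^-1) else 0.

Lemma exprn_le_fact_expR j (y : R) : 0 < y -> y ^+ j <= j`!%:R * expR y.
Proof.
move=> y0; case: j => [|j].
  by rewrite expr0 fact0 mul1r (le_trans _ (expR_ge1Dx y))// lerDl ltW.
rewrite mulrC -ler_pdivrMr ?ltr0n ?fact_gt0//.
by apply: le_trans (expR_ge1Dxn j (ltW y0)); rewrite lerDr.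
Qed.

Lemma poly_expR_bounded P j : exists2 C : R, 0 <= C &
  forall y, 0 < y -> `|P.[y]| * y ^+ j * expR (- y) <= C.
Proof.
elim/poly_ind: P j => [|P c IH] j.
  by exists 0 => // y _; rewrite horner0 normr0 !mul0r.
have [C C0 HC] := IH j.+1.
exists (C + `|c| * j`!%:R); first by rewrite addr_ge0// mulr_ge0.
move=> y y0; rewrite hornerMXaddC.
have e0 : 0 < expR (- y) by exact: expR_gt0.
apply: (@le_trans _ _ ((`|P.[y]| * y + `|c|) * y ^+ j * expR (- y))).
  rewrite ler_wpM2r ?(ltW e0)// ler_wpM2r ?exprn_ge0 ?(ltW y0)//.
  by rewrite (le_trans (ler_normD _ _))// normrM (gtr0_norm y0).
rewrite !mulrDl; apply: lerD.
  by rewrite -[X in X * _](mulrA _ y) -exprS; exact: HC.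
rewrite -mulrA ler_wpM2l// expRN ler_pdivrMr ?expR_gt0//.
exact: exprn_le_fact_expR.
Qed.

Definition flat_exp_deriv P : {poly R} := 'X^2 * (P - P^`()).

Lemma near_is_derive (f g : R -> R) (x d : R) : (\forall z \near x, f z = g z) ->
  is_derive x 1 g d -> is_derive x 1 f d.
Proof.
move=> fg [dg <-]; apply: DeriveDef; last exact: near_eq_derive.
by apply: (near_eq_derivable (f := g)) => //; apply: filterS fg => z ->.
Qed.

Lemma is_derive_quadratic_flat (f : R -> R) (C : R) :
  f 0 = 0 -> (forall x, `|f x| <= C * x ^+ 2) -> is_derive (0 : R) 1 f 0.
Proof.
move=> f0 fC.
have C0 : 0 <= C by have := fC 1; rewrite expr1n mulr1; apply: le_trans.
have lim0 : h^-1 *: ((f \o shift 0) (h *: (1 : R)) - f 0) @[h --> (0 : R)^'] --> (0 : R).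
  apply/cvgr0Pnorm_le => e e0; near=> h.
  have h0 : h != 0 by near: h; exact: nbhs_dnbhs_neq.
  rewrite f0 subr0 /= addr0 normrM normfV [h *: 1]mulr1.
  rewrite ler_pdivrMl ?normr_gt0// (le_trans (fC h))//.
  rewrite -(real_normK (num_real h)) expr2 mulrCA ler_wpM2l//.
  have hC : `|h| <= e / (C + 1).
    near: h; apply: dnbhs0_le; rewrite divr_gt0// ltr_wpDl//.
  apply: (@le_trans _ _ (C * (e / (C + 1)))); first by rewrite ler_wpM2l.
  by rewrite mulrCA -[leRHS]mulr1 ler_wpM2l ?(ltW e0)// ler_pdivrMr ?mul1r ?lerDl// ltr_wpDl.
apply: DeriveDef; first by apply/cvg_ex; exists 0.
exact: cvg_lim.
Unshelve. all: by end_near. Qed.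

(** At 0, boundedness of P(y) y^2 exp(-y) for y = 1 / x > 0 shows that the
    function is quadratically flat. *)
Lemma is_derive_flat_exp P (x : R) :
  is_derive x 1 (flat_exp P) (flat_exp (flat_exp_deriv P) x).
Proof.
have [x0|x0|->] := ltgtP x 0.
- rewrite {2}/flat_exp ltNge (ltW x0)/=.
  have d0 : is_derive (x : R) 1 (cst 0 : R -> R) (0 : R) := is_derive_cst 0 x 1.
  apply: near_is_derive d0.
  near=> z; rewrite /flat_exp ltNge ltW//; near: z; exact: lt_nbhsl.
- rewrite {2}/flat_exp x0.
  pose g (y : R) := P.[y^-1] * expR (- y^-1).
  apply: (@near_is_derive _ g).
    by near=> z; rewrite /flat_exp ifT//; near: z; exact: lt_nbhsr.
  have xn : x != 0 by rewrite gt_eqF.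
  have dV : is_derive x 1 (fun y : R => y^-1) (- x ^- 2 *: 1).
    by apply: is_deriveV.
  have d1 := is_derive1_comp (is_derive_poly P x^-1) dV.
  have dNV : is_derive x 1 (fun y : R => - y^-1) (- (- x ^- 2 *: 1)) := is_deriveN dV.
  have d2 := @is_derive1_comp _ expR (fun y : R => - y^-1) x _ _ (is_derive_expR (- x^-1)) dNV.
  have dg : is_derive x 1 g _ := is_deriveM d1 d2.
  apply: (is_derive_eq dg).
  rewrite /flat_exp_deriv hornerM hornerXn hornerD hornerN /GRing.scale/=.
  by rewrite exprVn; ring.
- rewrite {2}/flat_exp ltxx.
  have [C C0 HC] := poly_expR_bounded P 2.
  apply: (@is_derive_quadratic_flat _ C); first by rewrite /flat_exp ltxx.
  move=> y; rewrite /flat_exp; case: ifPn => y0; last by rewrite normr0 mulr_ge0// sqr_ge0.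
  have := HC y^-1; rewrite invr_gt0 => /(_ y0).
  rewrite exprVn mulrAC ler_pdivrMr ?exprn_gt0//.
  by rewrite normrM (gtr0_norm (expR_gt0 _)).
Unshelve. all: by end_near. Qed.

(** A sum, rather than a single product, because Leibniz' rule doubles the number
    of terms: this family is closed under differentiation, which gives smoothness
    at all orders at once. *)
Definition bump_sum (N : R) l (x : R) : R :=
  \sum_(p <- l) flat_exp p.1 x * flat_exp p.2 (N - x).

Definition bump_deriv l : seq ({poly R} * {poly R}) :=
  [seq (flat_exp_deriv p.1, p.2) | p <- l] ++
  [seq (p.1, - flat_exp_deriv p.2) | p <- l].

Lemma flat_expN P x : flat_exp (- P) x = - flat_exp P x.
Proof. by rewrite /flat_exp; case: ifP; rewrite ?oppr0// hornerN mulNr. Qed.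

Lemma is_derive_bump_sum N l (x : R) :
  is_derive x 1 (bump_sum N l) (bump_sum N (bump_deriv l) x).
Proof.
rewrite /bump_sum /bump_deriv big_cat/= !big_map/= -big_split/=.
elim: l => [|p l IH].
  rewrite big_nil (_ : (fun _ => _) = cst 0); first exact: is_derive_cst.
  by apply/funext => y; rewrite big_nil.
rewrite (_ : (fun _ => _) = (fun y => flat_exp p.1 y * flat_exp p.2 (N - y)) +
   (fun y => \sum_(p <- l) flat_exp p.1 y * flat_exp p.2 (N - y))); last first.
  by apply/funext => y; rewrite big_cons.
rewrite big_cons; apply: is_deriveD.
have dN : is_derive x 1 (fun y : R => N - y) (0 - 1) by apply: is_deriveB.
have d2 := @is_derive1_comp _ (flat_exp p.2) (fun y : R => N - y) x _ _
  (is_derive_flat_exp p.2 (N - x)) dN.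
have dM := is_deriveM (is_derive_flat_exp p.1 x) d2.
apply: (is_derive_eq dM).
by rewrite flat_expN /GRing.scale/=; ring.
Qed.

Lemma bump_sum_smooth N l k (x : R) : derivable (derive1n k (bump_sum N l)) x 1.
Proof.
suff [l' ->] : exists l', derive1n k (bump_sum N l) = bump_sum N l'.
  by case: (is_derive_bump_sum N l' x).
elim: k => [|k [l' IH]]; first by exists l.
exists (bump_deriv l'); rewrite derive1nS IH; apply/funext => y.
by rewrite derive1E; have [_ ->] := is_derive_bump_sum N l' y.
Qed.

Lemma bump_exists (N : R) : exists xi : R -> R,
  [/\ Ccinfty1 xi, forall t, 0 <= xi t & forall t, 0 < t < N -> 0 < xi t].
Proof.
exists (bump_sum N [:: (1, 1)]).
have E x : bump_sum N [:: (1, 1)] x = flat_exp 1 x * flat_exp 1 (N - x).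
  by rewrite /bump_sum big_seq1.
have f0 y : 0 <= flat_exp 1 y.
  by rewrite /flat_exp; case: ifP => // _; rewrite hornerC mul1r expR_ge0.
have f1 y : 0 < y -> 0 < flat_exp 1 y.
  by move=> y0; rewrite /flat_exp y0 hornerC mul1r expR_gt0.
split.
- split; first by move=> k t; exact: bump_sum_smooth.
  apply: (@subclosed_compact _ _ `[0, N]); [exact: closed_closure|exact: segment_compact|].
  rewrite [X in _ `<=` X](closure_id _).1; last exact: interval_closed.
  apply: closure_subset => x /=; rewrite E in_itv/= /flat_exp.
  by case: ltP => [/ltW ->|]; rewrite ?mul0r ?eqxx//; case: ltP => [|]; rewrite ?mulr0 ?eqxx// subr_gt0 => /ltW ->.
- by move=> t; rewrite E mulr_ge0.
- by move=> t /andP[t0 tN]; rewrite E mulr_gt0 ?f1// subr_gt0.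
Qed.

End Bump.

(** * Coupling at the junction and traces on the network *)

Section Coupling.
Context {R : realType}.

Lemma lipschitz_between_sum (I : finType) rmax (G : I -> R -> R) (K : I -> R) :
  (forall i, lipschitz_between rmax (K i) (G i)) ->
  lipschitz_between rmax (\sum_i K i) (fun x => \sum_i G i x).
Proof.
move=> lG x y xr yr; rewrite -sumrB mulr_suml.
by apply: le_trans (ler_norm_sum _ _ _) _; apply: ler_sum => i _; exact: lG.
Qed.

Lemma godunov_lipschitzr rmax K F a : 0 < K -> lipschitz_between rmax K F ->
  0 <= a <= rmax -> lipschitz_between rmax K (godunov F a : R -> R).
Proof.
move=> K0 lF ar x y xr yr.
rewrite !(godunov_opp K0 lF ar)// -opprD normrN.
exact: (godunov_lipschitzl K0 (lipschitz_between_opp lF) ar).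
Qed.

Lemma godunov_ge0 rmax K F a b : 0 < K -> lipschitz_between rmax K F ->
  (forall r, 0 <= r <= rmax -> 0 <= F r) ->
  0 <= a <= rmax -> 0 <= b <= rmax -> 0 <= godunov F a b :> R.
Proof.
move=> K0 lF F0 ar br; have [s Fs] := riemann_state_exists K0 lF ar br.
have [-> _] := godunov_riemann_state Fs; apply: F0.
case: Fs => + _ _; have /andP[? ?] := ar; have /andP[? ?] := br.
by rewrite ge_min le_max => /andP[] /orP[] ? /orP[] ?; lra.
Qed.

Lemma godunov_le_ends rmax K F a b : 0 < K -> lipschitz_between rmax K F ->
  0 <= a <= rmax -> 0 <= b <= rmax -> a <= b ->
  godunov F a b <= F a /\ godunov F a b <= F b :> R.
Proof.
move=> K0 lF ar br ab; have [s Fs] := riemann_state_exists K0 lF ar br.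
have [-> _] := godunov_riemann_state Fs; case: Fs => _ m _.
by split; apply: m; rewrite ?lexx ?ab.
Qed.

(** At p = 0 the outgoing fluxes are at most f 0 = 0 and the incoming ones are
    nonnegative; at p = rmax the incoming fluxes are at most f rmax = 0 and the
    outgoing ones are nonnegative. *)
Lemma junction_coupling (m n : nat) rmax (f : 'I_(m + n) -> R -> R)
    (K : 'I_(m + n) -> R) (u : 'I_(m + n) -> R) : 0 < rmax ->
  (forall h, 0 < K h) -> (forall h, lipschitz_between rmax (K h) (f h)) ->
  (forall h r, 0 <= r <= rmax -> 0 <= f h r) ->
  (forall h, f h 0 = 0) -> (forall h, f h rmax = 0) ->
  (forall h, 0 <= u h <= rmax) ->
  exists2 p, 0 <= p <= rmax &
    \sum_(i < m) godunov (f (lshift n i)) (u (lshift n i)) p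
    = \sum_(j < n) godunov (f (rshift m j)) p (u (rshift m j)).
Proof.
move=> r0 K0 lf f_ge0 f0 fr ur.
have zr : 0 <= (0 : R) <= rmax by rewrite lexx ltW.
have rr : 0 <= rmax <= rmax by rewrite lexx (ltW r0).
pose G p := \sum_(i < m) godunov (f (lshift n i)) (u (lshift n i)) p.
pose G' p := \sum_(j < n) godunov (f (rshift m j)) p (u (rshift m j)).
have lG : lipschitz_between rmax (\sum_(i < m) K (lshift n i)) G.
  by apply: lipschitz_between_sum => i; apply: godunov_lipschitzr.
have lG' : lipschitz_between rmax (\sum_(j < n) K (rshift m j)) G'.
  by apply: lipschitz_between_sum => j; apply: godunov_lipschitzl.
set k := \sum_(i < m) _ in lG; set k' := \sum_(j < n) _ in lG'.
have k0 : 0 <= k by apply: sumr_ge0 => i _; exact: ltW.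
have k'0 : 0 <= k' by apply: sumr_ge0 => i _; exact: ltW.
have lD : lipschitz_between rmax (k + k' + 1) (fun p => G p - G' p).
  move=> x y xr yr; have := lerD (lG x y xr yr) (lG' x y xr yr).
  move=> h; rewrite [X in `|X|](_ : _ = (G x - G y) - (G' x - G' y)); last by ring.
  apply: (le_trans (ler_normB _ _)); apply: (le_trans h).
  by rewrite -mulrDl ler_wpM2r// lerDl.
have kk : 0 < k + k' + 1 by rewrite ltr_wpDl ?addr_ge0.
have D0 : 0 <= G 0 - G' 0.
  rewrite subr_ge0 (@le_trans _ _ 0)//.
    apply: sumr_le0 => j _; have /andP[u0 _] := ur (rshift m j).
    by have [+ _] := godunov_le_ends (K0 (rshift m j)) (lf (rshift m j)) zr (ur (rshift m j)) u0; rewrite f0.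
  apply: sumr_ge0 => i _.
  exact: (godunov_ge0 (K0 (lshift n i)) (lf _) (f_ge0 _) (ur (lshift n i)) zr).
have Dr : G rmax - G' rmax <= 0.
  rewrite subr_le0 (@le_trans _ _ 0)//.
    apply: sumr_le0 => i _; have /andP[_ u1] := ur (lshift n i).
    by have [_] := godunov_le_ends (K0 (lshift n i)) (lf (lshift n i)) (ur (lshift n i)) rr u1; rewrite fr.
  apply: sumr_ge0 => j _.
  exact: (godunov_ge0 (K0 (rshift m j)) (lf _) (f_ge0 _) rr (ur (rshift m j))).
have := @IVT R (fun p => G p - G' p) 0 rmax 0 (ltW r0)
  (lipschitz_within kk lD (lexx 0) (lexx rmax)).
rewrite ge_min le_max D0 Dr orbT => /(_ isT)[p].
by rewrite in_itv/= => pr /eqP; rewrite subr_eq0 => /eqP ?; exists p.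
Qed.
End Coupling.

Section TestFunction1.
Context {R : realType}.

Lemma Ccinfty1_bounded (xi : R -> R) : Ccinfty1 xi ->
  measurable_fun setT xi /\ exists M T, (forall t, `|xi t| <= M) /\
    (forall t, T < `|t| -> xi t = 0).
Proof.
case=> dxi cxi.
have xic : continuous xi.
  move=> t; apply: differentiable_continuous; apply/derivable1_diffP.
  exact: (dxi 0%N t).
split; first exact: continuous_measurable_fun.
have [T supp] : exists T : R, forall t, T < `|t| -> xi t = 0.
  have [M [_ MM]] := compact_bounded cxi.
  exists (`|M| + 1) => t h; apply/eqP; apply/negPn/negP => xi0.
  move: h; rewrite ltNge => /negP; apply; apply: MM.
    by rewrite (le_lt_trans (ler_norm _)) ?ltrDl.
  exact: subset_closure.
have [M [_ MM]] := compact_bounded (continuous_compact (continuous_subspaceT xic)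
  (@segment_compact R (- T) T)).
exists (`|M| + 1), T; split=> // t; have [tT|Tt] := leP `|t| T.
  apply: MM; first by rewrite (le_lt_trans (ler_norm _)) ?ltrDl.
  by exists t => //; rewrite /= in_itv/= -ler_norml.
by rewrite supp// normr0.
Qed.
End TestFunction1.

Section NetworkTraces.
Context {R : realType} {m n : nat}.
Local Notation mu := (@lebesgue_measure R).
Local Notation Rplus := (`[(0 : R), +oo[%classic : set R).
Implicit Types h : 'I_(m + n).

Lemma ae_imply2 (P Q S : R -> Prop) : (forall t, P t -> Q t -> S t) ->
  {ae mu, forall t, P t} -> {ae mu, forall t, Q t} -> {ae mu, forall t, S t}.
Proof.
move=> PQS nP nQ; apply: negligibleS (negligibleU nP nQ) => t nS.
have [Pt|nPt] := pselect (P t); [right=> Qt|by left].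
by apply: nS; exact: PQS.
Qed.

Lemma near_junction_measure h (k : R) : 0 < k ->
  [/\ measurable (near_junction h k), near_junction h k `<=` road h &
      mu (near_junction h k) = k%:E].
Proof.
move=> k0; rewrite /near_junction /road; case: ifP => _; split=> //.
- by move=> x /=; rewrite !in_itv/= => /andP[].
- by rewrite lebesgue_measure_itv/= lte_fin oppr_lt0 k0 -EFinB opprK add0r.
- by move=> x /=; rewrite !in_itv/= andbT => /andP[].
- by rewrite lebesgue_measure_itv/= lte_fin k0 -EFinB subr0.
Qed.

Lemma measurable_road h : measurable (road h : set R).
Proof. by rewrite /road; case: ifP. Qed.

(** The sets ]0, N[ on which the bumps are positive exhaust the positive times. *)
Lemma trace_unique rmax h (r : R * R -> R) (g1 g2 : R -> R) :
  measurable_fun (Rplus `*` road h) r ->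
  is_trace rmax h r g1 -> is_trace rmax h r g2 ->
  {ae mu, forall t, 0 <= t -> g1 t = g2 t}.
Proof.
move=> mr [[mg1 _] c1] [[mg2 _] c2].
have local_eq (N : nat) : {ae mu, forall t, 0 < t < N%:R -> g1 t = g2 t}.
  have [xi [cxi xi0 xip]] := bump_exists (N%:R : R).
  have [mxi _] := Ccinfty1_bounded cxi.
  have I0 := trace_weak_unique (measurable_road h) (@near_junction_measure h) mr
    mg1 mg2 mxi xi0 (c1 _ cxi) (c2 _ cxi).
  have mf : measurable_fun Rplus (fun t => (xi t * `|g1 t - g2 t|)%:E).
    apply/measurable_EFinP; apply: measurable_funM; first exact: measurable_funTS.
    by apply: measurableT_comp => //; exact: measurable_funB.
  have := (ae_eq_integral_abs mu (measurable_itv _) mf).1.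
  have -> : (\int[mu]_(x in Rplus) `|(xi x * `|g1 x - g2 x|)%:E| = 0)%E.
    rewrite -[RHS]I0; apply: eq_integral => t _.
    by rewrite gee0_abs// lee_fin mulr_ge0.
  move=> /(_ erefl) ae0; apply: (ae_imply2 _ ae0 ae0) => t /= ht _ /andP[t0 tN].
  have /ht [] : Rplus t by rewrite /= in_itv/= ltW.
  move/eqP; rewrite mulf_eq0 gt_eqF ?xip ?t0//= normr_eq0 subr_eq0.
  by move/eqP.
have nonzero : {ae mu, forall t : R, t != 0}.
  exists [set 0]; split=> //; first exact: lebesgue_measure_set1.
  by move=> t /= /negP; rewrite negbK => /eqP.
apply: (ae_imply2 _ nonzero (ae_foralln local_eq)) => t tn H t0.
have tp : 0 < t by rewrite lt_neqAle eq_sym tn.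
by apply: (H (Num.bound t)); rewrite tp archi_boundP.
Qed.

Variables (rmax K : R) (F : R -> R) (a b : R).
Hypothesis (K0 : 0 < K) (lF : lipschitz_between rmax K F).
Hypothesis (ar : 0 <= a <= rmax) (br : 0 <= b <= rmax).

(** The absolute value serves incoming and outgoing roads at once. *)
Definition road_solution (z : R * R) := self_similar_state F a b (`|z.2| / z.1).

Lemma measurable_road_solution : measurable_fun setT road_solution.
Proof.
apply: (measurableT_comp (measurable_self_similar_state K0 lF ar br)).
apply: measurable_funM; first exact: (measurableT_comp _ measurable_snd).
exact: (measurableT_comp measurable_inv measurable_fst).
Qed.

Lemma road_solution_trace : exists g,
  [/\ 0 <= g <= rmax, riemann_state F a b g &
      forall h, is_trace rmax h road_solution (cst g)].
Proof.
have [g [gr Fg wg wg0]] := self_similar_trace K0 lF ar br.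
exists g; split=> // h; split; first by split=> // t _; rewrite in_itv.
move=> xi /Ccinfty1_bounded[mxi [M [T [xiM xiT]]]].
have := trace_limit K0 lF ar br gr wg wg0 mxi xiM xiT.
apply: cvg_trans; apply: near_eq_cvg; near=> k.
have k0 : 0 < k by near: k; exact: nbhs_right_gt.
have inner t : (\int[mu]_(x in near_junction h k) (xi t * `|road_solution (t, x) - cst g t|)%:E
    = \int[mu]_(x in `]0%R, k[) (xi t * `|self_similar_state F a b (x / t) - g|)%:E)%E.
  rewrite /near_junction; case: ifP => _; last first.
    apply: eq_integral => x; rewrite inE/= in_itv/= => /andP[x0 _].
    by rewrite /road_solution/= (gtr0_norm x0).
  rewrite integral_reflect//; last first.
    apply: measurable_funTS; apply/measurable_EFinP; apply: measurable_funM => //.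
    apply: measurableT_comp => //; apply: measurable_funB => //.
    apply: (measurableT_comp (f := road_solution) (g := pair t)).
      exact: measurable_road_solution.
    exact: pair1_measurable.
  have -> : (-%R : R -> R) @^-1` `](- k), 0[%classic = `]0, k[%classic.
    by apply/seteqP; split=> x /=; rewrite !in_itv/= oppr_lt0 ltrN2 andbC.
  apply: eq_integral => x; rewrite inE/= in_itv/= => /andP[x0 _].
  by rewrite /road_solution/= normrN (gtr0_norm x0).
apply: (congr1 (fun z => (k^-1)%:E * z)%E).
by apply: eq_integral => t _; rewrite inner.
Unshelve. all: by end_near. Qed.

End NetworkTraces.

(** * The Riemann problem at the junction *)

Unset Implicit Arguments.

Theorem lemma2p7 (R : realType) (m n : nat) (m_ge1 : (1 <= m)%N)
    (n_ge1 : (1 <= n)%N) (rmax : R) (rmax_gt0 : 0 < rmax)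
    (f : 'I_(m + n) -> R -> R) (L : 'I_(m + n) -> R)
    (f_flux : forall h, flux_condition rmax (L h) (f h))
    (f_nld : forall h, nondegenerate_nonlinearity rmax (f h))
    (u0 : 'I_(m + n) -> R) (u0_in : forall h, u0 h \in `[0, rmax]) :
  exists rho : 'I_(m + n) -> R * R -> R,
    [/\ Linfty_network rmax rho,
        self_similar rho,
        admissible_solution rmax f (fun h _ => u0 h) rho &
        exists2 u : 'I_(m + n) -> R, germ_VV rmax f u &
          forall gamma : 'I_(m + n) -> R -> R,
            (forall h, is_trace rmax h (rho h) (gamma h)) ->
            forall h, {ae (@lebesgue_measure R),
                        forall t, 0 <= t -> gamma h t = u h}].
Proof.
have /choice[K HK] : forall h, exists k, 0 < k /\ lipschitz_between rmax k (f h).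
  by move=> h; have [k k0 lk] := flux_lipschitz rmax_gt0 (f_flux h); exists k.
have K0 h : 0 < K h by have [] := HK h.
have lf h : lipschitz_between rmax (K h) (f h) by have [] := HK h.
have ur h : 0 <= u0 h <= rmax by have := u0_in h; rewrite in_itv.
have f_ge0 h r : 0 <= r <= rmax -> 0 <= f h r.
  by move=> rr; have [fp _ _ _ _] := f_flux h; apply: fp; rewrite in_itv.
have f0 h : f h 0 = 0 by have [_ _ _ [] ] := f_flux h.
have fr h : f h rmax = 0 by have [_ _ _ [] ] := f_flux h.
have [p pr sumE] := junction_coupling rmax_gt0 K0 lf f_ge0 f0 fr ur.
(* Incoming roads are reflected to x > 0, which changes the sign of the flux. *)
pose F (h : 'I_(m + n)) : R -> R := if (h < m)%N then fun r => - f h r else f h.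
have lF h : lipschitz_between rmax (K h) (F h).
  by rewrite /F; case: ifP => _ //; exact: lipschitz_between_opp.
have [g Hg] := choice (fun h => road_solution_trace (m := m) (n := n) (K0 h) (lF h) pr (ur h)).
have gr h : 0 <= g h <= rmax by have [] := Hg h.
pose rho h := road_solution (F h) p (u0 h).
have rho_trace h : is_trace rmax h (rho h) (cst (g h)) by have [_ _] := Hg h.
(* Whatever p is, each trace has the Godunov flux between p and the datum, and is
   stationary against p. *)
have in_state (i : 'I_m) (h := lshift n i) :
    godunov (f h) (u0 h) p = f h (g h) /\ godunov (f h) (g h) p = f h (g h).
  have [_ Fg _] := Hg h; rewrite /F /= ltn_ord in Fg.
  have [e1 e2] := godunov_riemann_state Fg.
  by rewrite !(godunov_opp (K0 h) (lf h))// e1 e2 opprK.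
have out_state (j : 'I_n) (h := rshift m j) :
    godunov (f h) p (u0 h) = f h (g h) /\ godunov (f h) p (g h) = f h (g h).
  have [_ Fg _] := Hg h; rewrite /F /= ltnNge leq_addr /= in Fg.
  exact: godunov_riemann_state Fg.
have gjunction : junction_condition f g p.
  split=> [i|j|].
  - by have [_ ->] := in_state i.
  - by have [_ ->] := out_state j.
  - transitivity (\sum_(i < m) godunov (f (lshift n i)) (u0 (lshift n i)) p).
      by apply: eq_bigr => i _; have [-> ->] := in_state i.
    by rewrite sumE; apply: eq_bigr => j _; have [-> ->] := out_state j.
exists rho; split.
- move=> h; split.
    apply: measurable_funTS; exact: (measurable_road_solution (K0 h) (lF h) pr (ur h)).
  by move=> z _; rewrite in_itv/=; exact: self_similar_state_range (K0 h) (lF h) pr (ur h) _.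
- move=> h; exists (fun s => self_similar_state (F h) p (u0 h) `|s|) => t x t0 _.
  by rewrite /rho /road_solution/= normrM normfV (gtr0_norm t0).
- split.
    move=> h k xi; rewrite in_itv/= => kr cxi xip xi0.
    have pos t x : 0 <= t -> road h x -> 0 <= xi (t, x).
      by move=> t0 hx; apply: xip => //; exact: subset_closure.
    rewrite /rho /F /road; move: pos; rewrite /road; case: ifP => _ pos.
      apply: (incoming_kruzhkov (K0 h) (lf h) pr (ur h) kr cxi xi0) => t x t0 x0.
      by apply: pos; rewrite //= in_itv.
    apply: (outgoing_kruzhkov (K0 h) (lf h) pr (ur h) kr cxi xi0) => t x t0 x0.
    by apply: pos; rewrite //= in_itv/= x0.
  exists (fun h => cst (g h)); split; first exact: rho_trace.
  exists (cst p); last by apply: aeW.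
  by split=> // t _; rewrite in_itv.
- exists g.
    split; first by move=> h; rewrite in_itv/=.
    by exists p => //; rewrite in_itv.
  move=> gamma Hgamma h.
  apply: (trace_unique _ (Hgamma h) (rho_trace h)).
  by apply: measurable_funTS; exact: (measurable_road_solution (K0 h) (lF h) pr (ur h)).
Qed.
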